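(* Let $\mathbb K$ be an algebraic extension of a finite field. Let $A$ be a finitely presented graded $\mathbb K$-algebra of linear growth, let $S$ be a finite set of homogeneous generators of $A$, and fix a degree-lexicographical order on the words over $S$. Then $A$ is automaton, i.e. its set of normal words with respect to this order is a regular language. In particular the Hilbert series of $A$ is rational.
   Context: Graded algebras are of the form $A=\bigoplus_{n\ge0}A_n$ with $A_0=\mathbb K$, finitely generated by homogeneous elements of positive degree; linear growth means $\dim A_n$ is bounded. A degree-lexicographical order compares words first by degree (sum of degrees of letters), then lexicographically. A word is normal if it is not the leading word of any element of the ideal of relations; $A$ is automaton if the normal words form a regular language. *)

(* Defs.v *)
From HB Require Import structures.
From mathcomp Require Import all_boot all_order all_algebra all_fingroup.
Set Implicit Arguments. Unset Strict Implicit. Unset Printing Implicit Defensive.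
Import GRing.Theory.
Local Open Scope ring_scope.

(* Alphabet S = 'I_n (the finite set of generators), degrees d : 'I_n -> nat. *)
(* Noncommutative polynomials of the free algebra K<S>, represented as formal
   finite linear combinations of words (lists of (coefficient, word)).
   Two representations denote the same element iff all coefficients agree. *)
Definition ncpoly (K : fieldType) (n : nat) := seq (K * seq 'I_n).

Definition coef (K : fieldType) n (p : ncpoly K n) (w : seq 'I_n) : K :=
  \sum_(t <- p | t.2 == w) t.1.

Definition wdeg n (d : 'I_n -> nat) (w : seq 'I_n) : nat := sumn (map d w).

Definition ncmon (K : fieldType) n (c : K) (u : seq 'I_n) (r : ncpoly K n)
  (v : seq 'I_n) : ncpoly K n :=
  [seq (c * t.1, u ++ t.2 ++ v) | t <- r].

Definition ideal_combo (K : fieldType) n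
  (ts : seq (K * seq 'I_n * ncpoly K n * seq 'I_n)) : ncpoly K n :=
  flatten [seq ncmon t.1.1.1 t.1.1.2 t.1.2 t.2 | t <- ts].

Definition in_ideal (K : fieldType) n (R : seq (ncpoly K n)) (f : ncpoly K n) : Prop :=
  exists ts : seq (K * seq 'I_n * ncpoly K n * seq 'I_n),
    all (fun t => t.1.2 \in R) ts /\
    forall w, coef f w = coef (ideal_combo ts) w.

Definition homog_of_deg (K : fieldType) n (d : 'I_n -> nat) (f : ncpoly K n) (k : nat) : Prop :=
  forall w, coef f w != 0 -> wdeg d w = k.

(* homogeneous relation of positive degree (so that A_0 = K) *)
Definition homog_pos (K : fieldType) n (d : 'I_n -> nat) (f : ncpoly K n) : Prop :=
  exists2 k, (0 < k)%N & homog_of_deg d f k.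

Definition lincomb (K : fieldType) n (cs : seq K) (fs : seq (ncpoly K n)) : ncpoly K n :=
  flatten [seq [seq (cf.1 * t.1, t.2) | t <- cf.2] | cf <- zip cs fs].

Definition indep_mod (K : fieldType) n (d : 'I_n -> nat) (R : seq (ncpoly K n))
  (k : nat) (fs : seq (ncpoly K n)) : Prop :=
  (forall f, f \in fs -> homog_of_deg d f k) /\
  forall cs : seq K, size cs = size fs -> in_ideal R (lincomb cs fs) ->
    forall c, c \in cs -> c = 0.

Definition graded_dim (K : fieldType) n (d : 'I_n -> nat) (R : seq (ncpoly K n))
  (k m : nat) : Prop :=
  (exists fs, size fs = m /\ indep_mod d R k fs) /\
  (forall fs, indep_mod d R k fs -> (size fs <= m)%N).

Definition linear_growth (K : fieldType) n (d : 'I_n -> nat) (R : seq (ncpoly K n)) : Prop :=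
  exists C : nat, forall k fs, indep_mod d R k fs -> (size fs <= C)%N.

Fixpoint lexlt n (s : 'I_n -> nat) (u v : seq 'I_n) : bool :=
  match u, v with
  | [::], [::] => false
  | [::], _ :: _ => true
  | _ :: _, [::] => false
  | a :: u', b :: v' => (s a < s b)%N || ((a == b) && lexlt s u' v')
  end.

Definition deglex_lt n (d : 'I_n -> nat) (s : 'I_n -> nat) (u v : seq 'I_n) : bool :=
  (wdeg d u < wdeg d v)%N || ((wdeg d u == wdeg d v) && lexlt s u v).

Definition leading_word (K : fieldType) n (d : 'I_n -> nat) (s : 'I_n -> nat)
  (f : ncpoly K n) (w : seq 'I_n) : Prop :=
  coef f w != 0 /\ forall w', coef f w' != 0 -> w' = w \/ deglex_lt d s w' w.

Definition normal_word (K : fieldType) n (d : 'I_n -> nat) (s : 'I_n -> nat)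
  (R : seq (ncpoly K n)) (w : seq 'I_n) : Prop :=
  ~ exists f, in_ideal R f /\ leading_word d s f w.

Definition regular_lang n (L : seq 'I_n -> Prop) : Prop :=
  exists (Q : finType) (q0 : Q) (delta : Q -> 'I_n -> Q) (F : pred Q),
    forall w, L w <-> F (foldl delta q0 w).

(* Hilbert series sum_k dim A_k t^k is rational: P/Q with Q(0)=1 *)
Definition hilbert_rational (K : fieldType) n (d : 'I_n -> nat) (R : seq (ncpoly K n)) : Prop :=
  exists h : nat -> nat, (forall k, graded_dim d R k (h k)) /\
    exists P Q : {poly rat}, Q`_0 = 1 /\
      forall k, \sum_(i < k.+1) Q`_i * (h (k - i)%N)%:R = P`_k.

(* Main.v *)
Require Import Defs.
From HB Require Import structures.
From mathcomp Require Import all_boot all_order all_algebra all_fingroup.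
From mathcomp Require Import finfield boolp zify ring.
Set Implicit Arguments. Unset Strict Implicit. Unset Printing Implicit Defensive.
Import GRing.Theory.
Local Open Scope ring_scope.

(** Let [D] bound the degrees of the generators and of the relations. Since the
    ideal of relations is [I = F R + I S], where [F] is the free algebra, the
    space [A_m] is the cokernel of a map between sums of the [A_k] with
    [m - D <= k < m], given by the right multiplications by generators between
    these components. In the bases of normal words these multiplications are
    matrices of bounded size, because the growth is linear. Their entries lie in
    a finite set: normal forms are unique, hence fixed by the power of the
    Frobenius endomorphism that fixes the coefficients of the relations. Adding
    the lexicographic comparisons between one-letter extensions of the normal
    words of degrees [m - D, ..., m - 1], one gets a state that ranges over a
    finite set and determines the next state. Hence the states are eventually
    periodic in [m], and so is the way in which normal words of degree [m]
    extend normal words of smaller degree. This yields a finite automaton on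
    pairs (class of the degree, rank of the word in its degree). *)

(** * The free algebra and its ideals *)

Section FreeAlgebra.
Variables (K : fieldType) (n : nat).
Implicit Types (f g r : ncpoly K n) (u v w x : seq 'I_n) (c : K).

(** Coefficients, normal forms and the maps [rho] below are all instances of this evaluation, so
    independence of the chosen representation is proved only once, in [linext_eq]. *)
Definition linext (V : lmodType K) (phi : seq 'I_n -> V) f : V :=
  \sum_(t <- f) t.1 *: phi t.2.

Lemma linext_cat (V : lmodType K) (phi : seq 'I_n -> V) f g :
  linext phi (f ++ g) = linext phi f + linext phi g.
Proof. by rewrite /linext big_cat. Qed.

Lemma linext_flatten (V : lmodType K) (phi : seq 'I_n -> V) (I : Type)
    (s : seq I) (F : I -> ncpoly K n) :
  linext phi (flatten [seq F i | i <- s]) = \sum_(i <- s) linext phi (F i).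
Proof.
elim: s => [|i s IH] /=; first by rewrite /linext !big_nil.
by rewrite linext_cat IH big_cons.
Qed.

Lemma linext_ncmon (V : lmodType K) (phi : seq 'I_n -> V) c u f v :
  linext phi (ncmon c u f v) = c *: linext (fun w => phi (u ++ w ++ v)) f.
Proof.
rewrite /linext /ncmon big_map scaler_sumr; apply: eq_bigr => t _ /=.
by rewrite scalerA.
Qed.

Lemma linext_coef_seq (V : lmodType K) (phi : seq 'I_n -> V) f (s : seq (seq 'I_n)) :
  uniq s -> {in f, forall t, t.2 \in s} ->
  linext phi f = \sum_(w <- s) coef f w *: phi w.
Proof.
move=> us fs.
transitivity (\sum_(w <- s) \sum_(t <- f | t.2 == w) t.1 *: phi t.2); last first.
  apply: eq_bigr => w _; rewrite /coef scaler_suml.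
  by apply: eq_bigr => t /eqP ->.
rewrite (exchange_big_dep xpredT) //= /linext !big_seq; apply: eq_bigr => t tf.
rewrite big_mkcond (bigD1_seq t.2) //=; last exact: fs.
by rewrite eqxx big1 ?addr0 // => w; rewrite eq_sym => /negPf ->.
Qed.

Lemma linext_eq (V : lmodType K) (phi : seq 'I_n -> V) f g :
  coef f =1 coef g -> linext phi f = linext phi g.
Proof.
move=> fg; pose s := undup (map snd (f ++ g)).
have us : uniq s by apply: undup_uniq.
rewrite !(@linext_coef_seq _ _ _ s us); first by apply: eq_bigr => w _; rewrite fg.
all: move=> t tfg; rewrite mem_undup map_f // mem_cat tfg ?orbT //.
Qed.

Lemma eq_linext (V : lmodType K) (phi psi : seq 'I_n -> V) f :
  {in f, forall t, phi t.2 = psi t.2} -> linext phi f = linext psi f.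
Proof.
by move=> pp; rewrite /linext !big_seq; apply: eq_bigr => t tf; rewrite pp.
Qed.

Lemma coef_linext f w : coef f w = linext (fun x => (x == w)%:R : K^o) f.
Proof.
rewrite /coef /linext big_mkcond; apply: eq_bigr => t _.
by case: eqP => _; rewrite -[_ *: _]/(_ * _) ?mulr1 ?mulr0.
Qed.

Lemma coef_nil w : coef ([::] : ncpoly K n) w = 0.
Proof. by rewrite /coef big_nil. Qed.

Lemma coef_cat f g w : coef (f ++ g) w = coef f w + coef g w.
Proof. by rewrite /coef big_cat. Qed.

Lemma coef_flatten (I : Type) (s : seq I) (F : I -> ncpoly K n) w :
  coef (flatten [seq F i | i <- s]) w = \sum_(i <- s) coef (F i) w.
Proof. by rewrite coef_linext linext_flatten; apply: eq_bigr => i _; rewrite coef_linext. Qed.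

Lemma coef_scale c f w : coef (ncmon c [::] f [::]) w = c * coef f w.
Proof.
rewrite !coef_linext linext_ncmon; set a := linext _ f; set b := linext _ f.
suff -> : a = b by [].
by apply: eq_linext => t _ /=; rewrite cats0.
Qed.

Lemma coef_mon c u w : coef [:: (c, u)] w = if u == w then c else 0.
Proof. by rewrite /coef big_cons big_nil /=; case: eqP; rewrite ?addr0. Qed.

Lemma coef_ncmon_eq c u v f g :
  coef f =1 coef g -> coef (ncmon c u f v) =1 coef (ncmon c u g v).
Proof.
by move=> fg w; rewrite !coef_linext !linext_ncmon (linext_eq _ fg).
Qed.

Lemma ncmonM c u v c' u' v' f :
  ncmon c u (ncmon c' u' f v') v = ncmon (c * c') (u ++ u') f (v' ++ v).
Proof.
rewrite /ncmon -map_comp; apply: eq_map => t /=.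
by rewrite mulrA !catA.
Qed.

Lemma ncmon_cat c u v f g : ncmon c u (f ++ g) v = ncmon c u f v ++ ncmon c u g v.
Proof. exact: map_cat. Qed.

Lemma coef_neq0_mem f w : coef f w != 0 -> w \in map snd f.
Proof.
apply: contraR => wf; rewrite /coef big1_seq // => t /andP[/eqP tw tf].
by rewrite -tw map_f in wf.
Qed.

Lemma coef_reduced f : exists s : seq (seq 'I_n),
  [/\ uniq s, forall w, (w \in s) = (coef f w != 0)
    & coef f =1 coef [seq (coef f w, w) | w <- s]].
Proof.
pose s := [seq w <- undup (map snd f) | coef f w != 0].
have us : uniq s by rewrite filter_uniq ?undup_uniq.
have sE w : (w \in s) = (coef f w != 0).
  rewrite mem_filter mem_undup; case: eqP => //= /eqP; exact: coef_neq0_mem.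
exists s; split=> // w; rewrite [RHS]/coef big_map /=.
have [ws|ws] := boolP (w \in s).
  rewrite big_mkcond (bigD1_seq w) //= eqxx big1 ?addr0 // => v.
  by move/negPf ->.
rewrite big1_seq; last by move=> v /andP[/eqP ->]; rewrite (negPf ws).
by apply/eqP; move: ws; rewrite sE negbK.
Qed.

End FreeAlgebra.

Section Ideal.
Variables (K : fieldType) (n : nat) (R : seq (ncpoly K n)).
Implicit Types (f g r : ncpoly K n) (u v w x : seq 'I_n) (c : K).

Lemma in_ideal_eq f g : coef f =1 coef g -> in_ideal R f -> in_ideal R g.
Proof. by move=> fg [ts [tsR fE]]; exists ts; split=> // w; rewrite -fg. Qed.

Lemma in_ideal_nil : in_ideal R [::].
Proof. by exists [::]. Qed.

Lemma in_ideal_cat f g : in_ideal R f -> in_ideal R g -> in_ideal R (f ++ g).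
Proof.
move=> [ts [tR fE]] [us [uR gE]]; exists (ts ++ us); split; first by rewrite all_cat tR.
by move=> w; rewrite /ideal_combo map_cat flatten_cat !coef_cat fE gE.
Qed.

Lemma in_ideal_mon c u v r : r \in R -> in_ideal R (ncmon c u r v).
Proof.
move=> rR; exists [:: (c, u, r, v)]; split; first by rewrite /= rR.
by move=> w; rewrite /ideal_combo /= cats0.
Qed.

Lemma in_ideal_ind (Q : ncpoly K n -> Prop) :
  (forall f g, coef f =1 coef g -> Q f -> Q g) -> Q [::] ->
  (forall f g, Q f -> Q g -> Q (f ++ g)) ->
  (forall c u r v, r \in R -> Q (ncmon c u r v)) ->
  forall f, in_ideal R f -> Q f.
Proof.
move=> Qeq Q0 Qcat Qmon f [ts [tsR fE]].
apply: (Qeq (ideal_combo ts)) => [w|]; first by rewrite fE.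
rewrite /ideal_combo; elim: ts tsR {fE} => //= t ts IH /andP[tR tsR].
by apply: Qcat; [apply: Qmon | apply: IH].
Qed.

Lemma in_ideal_ncmon c u v f : in_ideal R f -> in_ideal R (ncmon c u f v).
Proof.
move: f; apply: in_ideal_ind => [f g fg||f g|c' u' r v' rR].
- by apply: in_ideal_eq; apply: coef_ncmon_eq.
- exact: in_ideal_nil.
- by rewrite ncmon_cat; apply: in_ideal_cat.
- by rewrite ncmonM; apply: in_ideal_mon.
Qed.

Lemma in_ideal_flatten (I : eqType) (s : seq I) (F : I -> ncpoly K n) :
  {in s, forall i, in_ideal R (F i)} -> in_ideal R (flatten [seq F i | i <- s]).
Proof.
elim: s => [|i s IH] sF /=; first exact: in_ideal_nil.
apply: in_ideal_cat; first by apply: sF; rewrite mem_head.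
by apply: IH => j js; apply: sF; rewrite in_cons js orbT.
Qed.

Lemma in_ideal0 f : (forall w, coef f w = 0) -> in_ideal R f.
Proof. by move=> f0; apply: (in_ideal_eq _ in_ideal_nil) => w; rewrite f0 coef_nil. Qed.

Definition cong f g : Prop := in_ideal R (f ++ ncmon (-1) [::] g [::]).

Lemma cong_eq f g : coef f =1 coef g -> cong f g.
Proof. by move=> fg; apply: in_ideal0 => w; rewrite coef_cat coef_scale fg; ring. Qed.

Lemma cong_sym f g : cong f g -> cong g f.
Proof.
move/(in_ideal_ncmon (-1) [::] [::]); apply: in_ideal_eq => w.
by rewrite coef_scale !coef_cat !coef_scale; ring.
Qed.

Lemma cong_trans f g h : cong f g -> cong g h -> cong f h.
Proof.
move=> fg gh; apply: in_ideal_eq (in_ideal_cat fg gh) => w.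
by rewrite !coef_cat !coef_scale; ring.
Qed.

Lemma cong_cat f g f' g' : cong f g -> cong f' g' -> cong (f ++ f') (g ++ g').
Proof.
move=> fg gh; apply: in_ideal_eq (in_ideal_cat fg gh) => w.
by rewrite !(coef_cat, coef_scale); ring.
Qed.

Lemma cong_ncmon c u v f g : cong f g -> cong (ncmon c u f v) (ncmon c u g v).
Proof.
by move/(in_ideal_ncmon c u v); rewrite /cong ncmon_cat !ncmonM mulrC /= !cats0.
Qed.

Lemma cong_ideal f g : cong f g -> in_ideal R g -> in_ideal R f.
Proof.
move=> fg gI; apply: in_ideal_eq (in_ideal_cat fg gI) => w.
by rewrite !(coef_cat, coef_scale); ring.
Qed.

End Ideal.

Lemma sub_in_ideal (K : fieldType) n (R R' : seq (ncpoly K n)) f :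
  (forall r, r \in R -> in_ideal R' r) -> in_ideal R f -> in_ideal R' f.
Proof.
move=> RR'; move: f; apply: in_ideal_ind => [f g fg||f g|c u r v rR].
- exact: in_ideal_eq.
- exact: in_ideal_nil.
- exact: in_ideal_cat.
- by apply/in_ideal_ncmon/RR'.
Qed.

(** * Degree-lexicographic order *)

Section Order.
Variables (n : nat) (d : 'I_n -> nat) (s : 'I_n -> nat).
Hypotheses (d_pos : forall a, (0 < d a)%N) (s_inj : injective s).
Implicit Types (u v w x y p q : seq 'I_n).

Lemma wdeg_cat u v : wdeg d (u ++ v) = (wdeg d u + wdeg d v)%N.
Proof. by rewrite /wdeg map_cat sumn_cat. Qed.

Lemma wdeg_rcons u a : wdeg d (rcons u a) = (wdeg d u + d a)%N.
Proof. by rewrite -cats1 wdeg_cat /wdeg /= addn0. Qed.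

Lemma wdeg_eq0 u : wdeg d u = 0%N -> u = [::].
Proof. by case: u => // a u; rewrite /wdeg /=; have := d_pos a; lia. Qed.

Lemma size_le_wdeg u : (size u <= wdeg d u)%N.
Proof. by elim: u => // a u IH; rewrite /wdeg /= -/(wdeg d u); have := d_pos a; lia. Qed.

Lemma prefix_wdeg u v : prefix u v -> (wdeg d v <= wdeg d u)%N -> u = v.
Proof.
case/prefixP => w ->; rewrite wdeg_cat => wle.
by rewrite (@wdeg_eq0 w) ?cats0 //; lia.
Qed.

Lemma lexlt_irr u : lexlt s u u = false.
Proof. by elim: u => //= a u ->; rewrite ltnn andbF. Qed.

Lemma lexlt_trans u v w : lexlt s u v -> lexlt s v w -> lexlt s u w.
Proof.
elim: u v w => [|a u IH] [|b v] [|c w] //=.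
case/orP=> [ab|/andP[/eqP -> uv]]; case/orP=> [bc|/andP[/eqP <- vw]].
- by rewrite (ltn_trans ab bc).
- by rewrite ab.
- by rewrite bc.
- by rewrite eqxx (IH _ _ uv vw) orbT.
Qed.

Lemma lexlt_total u v : u != v -> lexlt s u v = ~~ lexlt s v u.
Proof.
elim: u v => [|a u IH] [|b v] //=; rewrite eqseq_cons.
have [<-|ab] /= := eqVneq a b; first by rewrite !ltnn /=; exact: IH.
move=> _; rewrite !orbF ltn_neqAle leqNgt.
by rewrite (inj_eq s_inj) ab.
Qed.

Lemma lexlt_catl p y v : ~~ prefix p y -> lexlt s (p ++ v) y = lexlt s p y.
Proof.
elim: p y => [|a p IH] [|b y] //=.
by case: eqVneq => //= ->; rewrite ltnn /= => h; apply: IH.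
Qed.

Lemma lexlt_cat p q u v : ~~ prefix p q -> ~~ prefix q p ->
  lexlt s (p ++ u) (q ++ v) = lexlt s p q.
Proof.
elim: p q => [|a p IH] [|b q] //=.
by case: eqVneq => [->|] //=; rewrite ?eqxx ltnn //=; exact: IH.
Qed.

Lemma lexlt_cat2l p u v : lexlt s (p ++ u) (p ++ v) = lexlt s u v.
Proof. by elim: p => //= a p ->; rewrite ltnn eqxx. Qed.

(** Since letters have positive degree, distinct words of equal degree are not prefixes of each
    other, so the first difference comes before the added letters. *)
Lemma lexlt_rcons_eqdeg u v a b : wdeg d u = wdeg d v -> u != v ->
  lexlt s (rcons u a) (rcons v b) = lexlt s u v.
Proof.
move=> uv neq; rewrite -!cats1 lexlt_cat //.
  by apply: contra neq => /prefix_wdeg-> //; rewrite uv.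
by apply: contra neq => /prefix_wdeg-> //; rewrite uv.
Qed.

(** A prefix of [v] of at least its degree is [v] itself, so [u] can be a prefix of [rcons v b] only
    by being equal to it. In all cases the letter [a] does not decide the comparison. *)
Lemma lexlt_rconsl u v a b : (wdeg d v <= wdeg d u)%N -> u != v ->
  lexlt s (rcons u a) (rcons v b) = lexlt s u (rcons v b).
Proof.
move=> vu neq; have [->|neq2] := eqVneq u (rcons v b).
  rewrite lexlt_irr -cats1 -[X in lexlt s _ X]cats0.
  by rewrite lexlt_cat2l.
rewrite -[rcons u a]cats1 lexlt_catl //; apply: contra neq => uv.
case/prefixP: uv neq2 => [x]; case/lastP: x => [|x c].
  by rewrite cats0 => ->; rewrite eqxx.
rewrite -rcons_cat => /rcons_inj[uv _] _.
by rewrite (@prefix_wdeg u v) // uv prefix_prefix.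
Qed.

Lemma lexlt_rcons2 u a b :
  lexlt s (rcons u a) (rcons u b) = (s a < s b)%N.
Proof. by rewrite -!cats1 lexlt_cat2l /= andbF orbF. Qed.

Lemma deglex_trans u v w :
  deglex_lt d s u v -> deglex_lt d s v w -> deglex_lt d s u w.
Proof.
rewrite /deglex_lt; case/orP=> [uv|/andP[/eqP -> uv]];
  case/orP=> [vw|/andP[/eqP <- vw]].
- by rewrite (ltn_trans uv vw).
- by rewrite uv.
- by rewrite vw.
- by rewrite eqxx (lexlt_trans uv vw) orbT.
Qed.

Lemma deglex_total u v : u != v -> deglex_lt d s u v || deglex_lt d s v u.
Proof.
move=> uv; rewrite /deglex_lt eq_sym.
by case: ltngtP => //= _; rewrite lexlt_total // orNb.
Qed.

Lemma deglex_rcons u v a : deglex_lt d s u v -> deglex_lt d s (rcons u a) (rcons v a).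
Proof.
rewrite /deglex_lt !wdeg_rcons ltn_add2r eqn_add2r.
case: ltngtP => //= uv h; rewrite lexlt_rcons_eqdeg //.
by apply: contraTneq h => ->; rewrite lexlt_irr.
Qed.

Lemma deglex_max (ws : seq (seq 'I_n)) : ws != [::] ->
  exists2 w, w \in ws & {in ws, forall x, x = w \/ deglex_lt d s x w}.
Proof.
elim: ws => // a [|b ws] IH _.
  by exists a; rewrite ?mem_head // => x; rewrite inE => /eqP ->; left.
have [//|w wws wmax] := IH.
have [aw|aw] := boolP (deglex_lt d s a w).
  exists w; first by rewrite in_cons wws orbT.
  by move=> x; rewrite in_cons => /orP[/eqP ->|/wmax //]; right.
exists a; first by rewrite mem_head.
have [eaw|neq] := eqVneq a w.
  by move=> x; rewrite in_cons => /orP[/eqP ->|/wmax]; [left | rewrite eaw].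
have wa : deglex_lt d s w a by have := deglex_total neq; rewrite (negPf aw).
move=> x; rewrite in_cons => /orP[/eqP ->|]; first by left.
by case/wmax => [->|xw]; right => //; apply: deglex_trans xw wa.
Qed.

Definition words m : seq (seq 'I_n) :=
  [seq w <- flatten [seq [seq tval t | t <- enum {: k.-tuple 'I_n}] | k <- iota 0 m.+1]
     | wdeg d w == m].

Lemma mem_words m w : (w \in words m) = (wdeg d w == m).
Proof.
rewrite mem_filter; case: eqP => // wm; rewrite andTb; apply/flatten_mapP.
exists (size w); first by rewrite mem_iota ltnS -wm size_le_wdeg.
by apply/mapP; exists (in_tuple w); rewrite ?mem_enum.
Qed.

(** The lexicographic order is not well founded on all words, but only finitely many words have
    degree [m]; the induction is on the number of smaller ones. *)
Lemma lex_ind m (Q : seq 'I_n -> Prop) :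
  (forall w, wdeg d w = m ->
     (forall x, wdeg d x = m -> lexlt s x w -> Q x) -> Q w) ->
  forall w, wdeg d w = m -> Q w.
Proof.
move=> step w; have [k] := ubnP (count (fun x => lexlt s x w) (words m)).
elim: k w => // k IH w wk wm; apply: step => // x xm xw; apply: IH => //.
rewrite -ltnS; apply: leq_trans wk; rewrite ltnS.
have := xw; have : x \in words m by rewrite mem_words xm.
elim: (words m) => //= y ys IHy; rewrite in_cons => /orP[/eqP <-|xys] h.
  rewrite lexlt_irr h add0n add1n ltnS; apply: sub_count => z zx.
  exact: lexlt_trans zx h.
have := IHy xys h; have : lexlt s y x -> lexlt s y w by move/lexlt_trans; apply.
by case: (lexlt s y x) => [->|] //; lia.
Qed.

End Order.

(** * Normal words and normal forms *)

Section NormalWords.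
Variables (K : fieldType) (n : nat) (d s : 'I_n -> nat) (R : seq (ncpoly K n)).
Hypotheses (d_pos : forall a, (0 < d a)%N) (s_inj : injective s).
Implicit Types (f g r : ncpoly K n) (u w : seq 'I_n) (m : nat).

(** This is a condition on the representation: terms that cancel must have degree [m] too. It is
    stronger than [homog_of_deg], and can be used term by term. *)
Definition shom m f := all (fun t => wdeg d t.2 == m) f.

Hypothesis R_shom : forall r, r \in R -> exists2 k, (0 < k)%N & shom k r.

Local Notation normal := (normal_word d s R).

Definition hpart m f : ncpoly K n := [seq t <- f | wdeg d t.2 == m].

Lemma shom_hpart m f : shom m (hpart m f).
Proof. exact: filter_all. Qed.

Lemma shomP m f : reflect {in f, forall t, wdeg d t.2 = m} (shom m f).
Proof. by apply: (iffP allP) => h t /h /eqP. Qed.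

Lemma shom_cat m f g : shom m (f ++ g) = shom m f && shom m g.
Proof. exact: all_cat. Qed.

Lemma shom_ncmon m c u f v :
  shom m f -> shom (wdeg d u + m + wdeg d v) (ncmon c u f v).
Proof.
move/shomP => fm; apply/shomP => t /mapP[t' t'f ->] /=.
by rewrite !wdeg_cat (fm _ t'f) addnA.
Qed.

Lemma shom_scale m c f : shom m f -> shom m (ncmon c [::] f [::]).
Proof. by move/(shom_ncmon c [::] [::]); rewrite addn0. Qed.

Lemma coef_shom m f w : shom m f -> coef f w != 0 -> wdeg d w = m.
Proof. by move/shomP => fm /coef_neq0_mem /mapP[t tf ->]; apply: fm. Qed.

Lemma coef_hpart m f w : coef (hpart m f) w = if wdeg d w == m then coef f w else 0.
Proof.
rewrite /coef big_filter_cond; case: ifP => wm.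
  by apply: eq_bigl => t; case: (eqVneq t.2 w) => [->|]; rewrite ?wm ?andbF.
by rewrite big1 // => t /andP[tm /eqP tw]; rewrite -tw tm in wm.
Qed.

Lemma hpart_homog m f : homog_of_deg d f m -> coef f =1 coef (hpart m f).
Proof.
move=> fm w; rewrite coef_hpart; case: eqP => // /eqP wm.
by apply/eqP; apply: contraR wm => /fm ->.
Qed.

Lemma in_ideal_hpart m f : in_ideal R f -> in_ideal R (hpart m f).
Proof.
move: f; apply: in_ideal_ind => [f g fg||f g|c u r v rR].
- by apply: in_ideal_eq => w; rewrite !coef_hpart fg.
- exact: in_ideal_nil.
- by rewrite /hpart filter_cat; apply: in_ideal_cat.
have [k _ rk] := R_shom rR; have fk := shom_ncmon c u v rk.
have [e|ne] := eqVneq (wdeg d u + k + wdeg d v)%N m.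
  rewrite /hpart (all_filterP _); last by rewrite -e.
  exact: in_ideal_mon.
apply: in_ideal0 => w; rewrite coef_hpart; case: eqP => // wm.
by apply/eqP; apply: contraR ne => /(coef_shom fk) <-; rewrite wm.
Qed.

Lemma leading_word_exists f w : coef f w != 0 -> exists x, leading_word d s f x.
Proof.
move=> fw; have [ws [_ wsE _]] := coef_reduced f.
have [|x xws xmax] := @deglex_max n d s s_inj ws.
  by apply: contraTneq fw => ws0; rewrite -wsE ws0.
exists x; split; first by rewrite -wsE.
by move=> y; rewrite -wsE; apply: xmax.
Qed.

(** A nonzero element has a leading word, and the leading word of an element of the ideal is not
    normal. *)
Lemma normal_indep f : in_ideal R f -> (forall w, coef f w != 0 -> normal w) ->
  forall w, coef f w = 0.
Proof.
move=> fI fn w; apply/eqP/negPn/negP => /leading_word_exists[x fx].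
by case: (fx) => /fn nx _; apply: nx; exists f.
Qed.

Lemma coef_rcons f u a : coef (ncmon 1 [::] f [:: a]) (rcons u a) = coef f u.
Proof.
rewrite !coef_linext linext_ncmon scale1r; apply: (@eq_linext _ _ K^o) => t _ /=.
by rewrite cats1 eqseq_rcons eqxx andbT.
Qed.

Lemma coef_rcons_neq0 f a w : coef (ncmon 1 [::] f [:: a]) w != 0 ->
  exists2 u, w = rcons u a & coef f u != 0.
Proof.
move=> fw; have /mapP[t /mapP[t' _ ->] wE] := coef_neq0_mem fw.
exists t'.2; first by rewrite wE /= cats1.
by move: fw; rewrite wE /= cats1 coef_rcons.
Qed.

(** Right multiplication by a letter preserves the order, hence carries leading words to leading
    words. *)
Lemma normal_rcons u a : normal (rcons u a) -> normal u.
Proof.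
move=> nua [f [fI [fu fmax]]]; apply: nua; exists (ncmon 1 [::] f [:: a]).
split; first exact: in_ideal_ncmon.
split; first by rewrite coef_rcons.
move=> w /coef_rcons_neq0[x -> /fmax[->|xu]]; first by left.
by right; apply: deglex_rcons.
Qed.

Lemma nonnormal_reduce w : ~ normal w -> exists2 f, in_ideal R f &
  [/\ coef f w = 1, shom (wdeg d w) f
    & forall x, coef f x != 0 -> x = w \/ lexlt s x w].
Proof.
move=> /contrapT[f [fI [fw fmax]]].
exists (ncmon (coef f w)^-1 [::] (hpart (wdeg d w) f) [::]).
  by apply/in_ideal_ncmon/in_ideal_hpart.
split; first by rewrite coef_scale coef_hpart eqxx mulVf.
  by apply/shom_scale/shom_hpart.
move=> x; rewrite coef_scale coef_hpart.
case: (wdeg d x =P wdeg d w) => [xw|]; last by rewrite mulr0 eqxx.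
rewrite mulf_eq0 negb_or => /andP[_ /fmax [->|]]; first by left.
by rewrite /deglex_lt xw ltnn eqxx; right.
Qed.

(** * Numbering of the normal words of each degree *)

Variable C0 : nat.
(** The bound is a successor so that ranks can be formed with [inord]. *)
Local Notation C := C0.+1.
Hypothesis growth : forall k fs, indep_mod d R k fs -> (size fs <= C)%N.

Lemma coef_lincomb_words (cs : seq K) (ws : seq (seq 'I_n)) w :
  uniq ws -> size cs = size ws ->
  coef (lincomb cs [seq [:: (1, x)] | x <- ws]) w =
  if w \in ws then nth 0 cs (index w ws) else 0.
Proof.
rewrite /lincomb; elim: ws cs => [|x ws IH] [|c cs] //=.
  by rewrite coef_nil.
move=> /andP[xws us] [sz].
rewrite -cat1s coef_cat coef_mon mulr1 IH // in_cons [w == x]eq_sym.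
case: eqVneq => [<-|] //=; last by rewrite add0r.
by rewrite (negPf xws) addr0.
Qed.

Lemma indep_normal m (ws : seq (seq 'I_n)) : uniq ws ->
  {in ws, forall w, wdeg d w = m /\ normal w} ->
  indep_mod d R m [seq [:: (1, x)] | x <- ws].
Proof.
move=> us wsn; split.
  move=> f /mapP[x /wsn[xm _] -> w]; rewrite coef_mon.
  by case: (x =P w) => [<-|]; rewrite ?eqxx.
move=> cs; rewrite size_map => sz fI c ccs.
have f0 : forall w, coef (lincomb cs [seq [:: (1, x)] | x <- ws]) w != 0 -> normal w.
  by move=> w; rewrite coef_lincomb_words //; case: ifP => [/wsn[]//|]; rewrite eqxx.
have := normal_indep fI f0 (nth [::] ws (index c cs)).
rewrite coef_lincomb_words // mem_nth ?index_uniq -?sz ?index_mem //.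
by rewrite nth_index.
Qed.

Lemma size_normal_words m (ws : seq (seq 'I_n)) : uniq ws ->
  {in ws, forall w, wdeg d w = m /\ normal w} -> (size ws <= C)%N.
Proof. by move=> us /(indep_normal us)/growth; rewrite size_map. Qed.

(* The normal words of degree [m] are numbered through their parents: the ranks
   in degree [m] depend only on the set of normal pairs (last letter, rank of
   the word without its last letter), not on the words themselves. *)
Definition cword_of (lev : nat -> seq (seq 'I_n)) m (x : 'I_n * 'I_C) :=
  rcons (nth [::] (lev (m - d x.1)%N) x.2) x.1.

Definition parents_of (lev : nat -> seq (seq 'I_n)) m : seq ('I_n * 'I_C) :=
  [seq x : 'I_n * 'I_C <- enum {: 'I_n * 'I_C} | [&& (d x.1 <= m)%N,
     (x.2 < size (lev (m - d x.1)%N))%N & `[< normal (cword_of lev m x) >]]].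

(** The recursion carries all earlier levels, because level [m] is built from the levels [m - d a]
    for all letters [a]. *)
Fixpoint levels m : seq (seq (seq 'I_n)) :=
  if m is m'.+1 then
    rcons (levels m') (map (cword_of (nth [::] (levels m')) m)
                         (parents_of (nth [::] (levels m')) m))
  else [:: [seq w <- [:: [::]] | `[< normal w >]]].

Definition level m := nth [::] (levels m) m.
Definition cword := cword_of level.
Definition parents := parents_of level.

Lemma size_levels m : size (levels m) = m.+1.
Proof. by elim: m => //= m IH; rewrite size_rcons IH. Qed.

Lemma nth_levels m k : (k <= m)%N -> nth [::] (levels m) k = level k.
Proof.
elim: m => [|m IH]; first by rewrite leqn0 => /eqP ->.
rewrite leq_eqVlt => /orP[/eqP -> //|km] /=.
by rewrite nth_rcons size_levels km IH.
Qed.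

Lemma levelE m : (0 < m)%N -> level m = map (cword m) (parents m).
Proof.
case: m => // m _; rewrite {1}/level /= nth_rcons size_levels ltnn eqxx.
have e (x : 'I_n * 'I_C) : nth [::] (levels m) (m.+1 - d x.1) = level (m.+1 - d x.1).
  by rewrite nth_levels //; have := d_pos x.1; lia.
rewrite /parents /parents_of.
have -> : [seq x : 'I_n * 'I_C <- enum {: 'I_n * 'I_C} | [&& (d x.1 <= m.+1)%N,
     (x.2 < size (nth [::] (levels m) (m.+1 - d x.1)%N))%N
     & `[< normal (cword_of (nth [::] (levels m)) m.+1 x) >]]] =
  [seq x : 'I_n * 'I_C <- enum {: 'I_n * 'I_C} | [&& (d x.1 <= m.+1)%N,
     (x.2 < size (level (m.+1 - d x.1)%N))%N
     & `[< normal (cword_of level m.+1 x) >]]].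
  by apply: eq_filter => x; rewrite /cword_of e.
by apply: eq_map => x; rewrite /cword /cword_of e.
Qed.

Lemma level0 : level 0 = [seq w <- [:: [::]] | `[< normal w >]].
Proof. by []. Qed.

Lemma mem_parents m (x : 'I_n * 'I_C) : (x \in parents m) =
  [&& (d x.1 <= m)%N, (x.2 < size (level (m - d x.1)%N))%N & `[< normal (cword m x) >]].
Proof. by rewrite mem_filter mem_enum andbT. Qed.

(** Strong induction on the degree: a normal word without its last letter is normal, so it is listed
    in an earlier level, with rank below [C] by the growth bound. A word is determined by its last
    letter and the rank of the rest, which excludes repetitions. *)
Lemma level_spec m : uniq (level m) /\
  forall w, w \in level m <-> wdeg d w = m /\ normal w.
Proof.
have [k] := ubnP m; elim: k m => // k IH m mk.
case: (posnP m) => [->|m_gt0].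
  rewrite level0; split; first by rewrite filter_uniq.
  move=> w; rewrite mem_filter inE; split=> [/andP[/asboolP nw /eqP w0]|].
    by split=> //; rewrite w0.
  by case=> /wdeg_eq0 -/(_ d_pos) -> nw; rewrite eqxx andbT; apply/asboolP.
have IHm a : (d a <= m)%N -> uniq (level (m - d a)) /\
    forall w, w \in level (m - d a) <-> wdeg d w = (m - d a)%N /\ normal w.
  by move=> am; apply: IH; have := d_pos a; lia.
rewrite levelE //; split.
  rewrite map_inj_in_uniq => [|[a i] [b j]]; first exact/filter_uniq/enum_uniq.
  rewrite !mem_parents /= => /and3P[am isz _] /and3P[_ jsz _].
  rewrite /cword /cword_of /= => /rcons_inj[e ab]; move: jsz e; rewrite -ab => jsz e.
  congr (_, _); apply/val_inj/eqP; have [u _] := IHm _ am.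
  by rewrite /= -(nth_uniq [::] isz jsz u) e.
move=> w; split.
  case/mapP => -[a i]; rewrite mem_parents /= => /and3P[am isz /asboolP nw] ->.
  split=> //; rewrite /cword /cword_of /= wdeg_rcons.
  have [_ h] := IHm _ am; have /h[-> _] := mem_nth [::] isz.
  by rewrite subnK.
case/lastP: w => [[m0]|w a [wm nw]]; first by rewrite -m0 in m_gt0.
rewrite wdeg_rcons in wm; have am : (d a <= m)%N by rewrite -wm leq_addl.
have [u h] := IHm _ am.
have wl : w \in level (m - d a).
  by apply/h; split; [rewrite -wm addnK | apply: normal_rcons nw].
have il : (index w (level (m - d a)) < C)%N.
  apply: leq_trans (@size_normal_words (m - d a)%N _ u _); first by rewrite index_mem.
  by move=> x /h.
have e : cword m (a, Ordinal il) = rcons w a.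
  by rewrite /cword /cword_of /= nth_index.
apply/mapP; exists (a, Ordinal il) => //.
rewrite mem_parents /= am index_mem wl e /=; exact/asboolP.
Qed.

Lemma level_uniq m : uniq (level m).
Proof. by have [] := level_spec m. Qed.

Lemma mem_level m w : w \in level m <-> wdeg d w = m /\ normal w.
Proof. by have [] := level_spec m. Qed.

Lemma size_level m : (size (level m) <= C)%N.
Proof. by apply: (@size_normal_words m _ (level_uniq m)) => w /mem_level. Qed.

Lemma wdeg_nth_level m i : (i < size (level m))%N -> wdeg d (nth [::] (level m) i) = m.
Proof. by move=> /(mem_nth [::])/mem_level[]. Qed.

Lemma index_level m w : w \in level m -> (index w (level m) < C)%N.
Proof. by rewrite -index_mem => h; apply: leq_trans h (size_level m). Qed.

(** * Normal forms as row vectors *)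

Definition nfp m (v : 'rV[K]_C) : ncpoly K n :=
  [seq (v 0 i, nth [::] (level m) i) | i : 'I_C <- enum 'I_C & (i < size (level m))%N].

(** All degrees share the ambient space of dimension [C], which allows data of different degrees to
    be compared. The coordinates beyond the level must vanish for [nfp m] to be injective. *)
Definition supported m (v : 'rV[K]_C) :=
  forall i : 'I_C, (size (level m) <= i)%N -> v 0 i = 0.

Lemma supported_lin m c (v v' : 'rV[K]_C) :
  supported m v -> supported m v' -> supported m (c *: v + v').
Proof. by move=> sv sv' i ci; rewrite !mxE sv // sv' // mulr0 addr0. Qed.

Lemma supported0 m : supported m 0.
Proof. by move=> i _; rewrite mxE. Qed.

Lemma linext_nfp (V : lmodType K) (phi : seq 'I_n -> V) m v :
  linext phi (nfp m v) =
  \sum_(i < C | (i < size (level m))%N) v 0 i *: phi (nth [::] (level m) i).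
Proof. by rewrite /linext /nfp big_map big_filter big_enum_cond. Qed.

Lemma shom_nfp m v : shom m (nfp m v).
Proof.
apply/shomP => t /mapP[i]; rewrite mem_filter => /andP[im _] -> /=.
exact: wdeg_nth_level.
Qed.

Lemma coef_nfp_lin m c v v' w :
  coef (nfp m (c *: v + v')) w = c * coef (nfp m v) w + coef (nfp m v') w.
Proof.
rewrite !coef_linext !linext_nfp mulr_sumr -big_split; apply: eq_bigr => i _ /=.
by rewrite !mxE /GRing.scale /=; ring.
Qed.

Lemma coef_nfp m v (i : 'I_C) : (i < size (level m))%N ->
  coef (nfp m v) (nth [::] (level m) i) = v 0 i.
Proof.
move=> im; rewrite coef_linext linext_nfp (bigD1 i) //= eqxx big1 ?addr0.
  by rewrite /GRing.scale /= mulr1.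
move=> j /andP[jm ji]; rewrite nth_uniq ?level_uniq // (negPf (ji : j != i :> nat)).
by rewrite scaler0.
Qed.

Lemma coef_nfp_neq0 m v w : coef (nfp m v) w != 0 ->
  exists2 i : 'I_C, (i < size (level m))%N & w = nth [::] (level m) i.
Proof.
move/coef_neq0_mem/mapP => [t /mapP[i]]; rewrite mem_filter => /andP[im _] -> ->.
by exists i.
Qed.

Lemma nfp_ideal m v : supported m v -> in_ideal R (nfp m v) -> v = 0.
Proof.
move=> sv /normal_indep nv; apply/rowP => i; rewrite mxE.
have [im|im] := ltnP i (size (level m)); last exact: sv.
rewrite -(coef_nfp v im); apply: nv => w /coef_nfp_neq0[j jm ->].
by have /mem_level[] := mem_nth [::] jm.
Qed.

Lemma nfp_cong m v v' : supported m v -> supported m v' ->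
  cong R (nfp m v) (nfp m v') -> v = v'.
Proof.
move=> sv sv' vv'; apply/eqP; rewrite -subr_eq0 addrC -scaleN1r; apply/eqP.
apply: (@nfp_ideal m); first exact: supported_lin.
apply: in_ideal_eq vv' => w; rewrite coef_nfp_lin coef_cat coef_scale; ring.
Qed.

Definition lexle x w := (x == w) || lexlt s x w.

Definition bounded m w (v : 'rV[K]_C) :=
  forall i : 'I_C, v 0 i != 0 -> lexle (nth [::] (level m) i) w.

Lemma bounded_lin m w c v v' : bounded m w v -> bounded m w v' ->
  bounded m w (c *: v + v').
Proof.
move=> bv bv' i; rewrite !mxE; have [/eqP vi|/bv//] := boolP (v 0 i == 0).
by rewrite vi mulr0 add0r; apply: bv'.
Qed.

(** By lexicographic induction inside one degree. A normal word is its own normal form; any other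
    word is the leading word of a homogeneous element of the ideal, and is congruent to a
    combination of smaller words. The bound by [w] will yield relations with a prescribed leading
    word. *)
Lemma nf_exists w : exists v, [/\ supported (wdeg d w) v,
  bounded (wdeg d w) w v & cong R [:: (1, w)] (nfp (wdeg d w) v)].
Proof.
have [m wm] : exists m, wdeg d w = m by exists (wdeg d w).
rewrite wm; move: w wm; apply: (@lex_ind n d s d_pos) => w wm IH.
have [nw|nw] := EM (normal w).
  have wl : w \in level m by apply/mem_level.
  have il := index_level wl; pose i := Ordinal il.
  exists (delta_mx 0 i); split.
  - move=> j mj; rewrite mxE eqxx; case: eqP => // ji.
    by move: mj; rewrite ji leqNgt index_mem wl.
  - move=> j; rewrite mxE eqxx /=; case: (j =P i) => [-> _|_]; last by rewrite eqxx.
    by rewrite /lexle nth_index ?eqxx.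
  - apply: cong_eq => x; rewrite coef_mon.
    have iE : nth [::] (level m) i = w by rewrite nth_index.
    case: eqP => [<-|wx].
      by rewrite -iE coef_nfp ?index_mem // mxE !eqxx.
    apply/esym/eqP/negPn/negP => h; have [j jm xE] := coef_nfp_neq0 h.
    move: h; rewrite xE coef_nfp // mxE eqxx /=.
    by case: (j =P i) => [ji|]; [case: wx; rewrite xE ji | rewrite eqxx].
have [f fI [fw fm flt]] := nonnormal_reduce nw; rewrite wm in fm.
have [ws [uws wsE fE]] := coef_reduced f.
(* The terms of [f] other than [w] are lexicographically smaller, so their normal forms are known
   and can be added up one by one. *)
have red (xs : seq (seq 'I_n)) : {subset xs <= ws} -> w \notin xs ->
  exists v, [/\ supported m v, bounded m w v
    & cong R [seq (coef f x, x) | x <- xs] (nfp m v)].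
  elim: xs => [|x xs IHx] xsw wxs.
    exists 0; split; first exact: supported0.
      by move=> i; rewrite mxE eqxx.
    apply: cong_eq => x; rewrite coef_nil; apply/esym/eqP/negPn/negP => h.
    by have [i im xE] := coef_nfp_neq0 h; rewrite xE coef_nfp // mxE eqxx in h.
  move: wxs; rewrite in_cons negb_or => /andP[wx wxs].
  have [|//|v' [sv' bv' cv']] := IHx.
    by move=> y yxs; apply: xsw; rewrite in_cons yxs orbT.
  have fx : coef f x != 0 by rewrite -wsE; apply: xsw; rewrite mem_head.
  have xm := coef_shom fm fx.
  have xw : lexlt s x w by case: (flt _ fx) => // e; rewrite e eqxx in wx.
  have [v [sv bv cv]] := IH x xm xw.
  exists (coef f x *: v + v'); split; first exact: supported_lin.
    apply: bounded_lin => // i /bv; rewrite /lexle.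
    by case/orP=> [/eqP ->|/lexlt_trans/(_ xw)->]; rewrite ?xw orbT.
  have := cong_cat (cong_ncmon (coef f x) [::] [::] cv) cv'.
  rewrite /= mulr1 cats0 => h; apply: cong_trans h _; apply: cong_eq => y.
  by rewrite coef_cat coef_scale coef_nfp_lin.
have ww : w \in ws by rewrite wsE fw oner_neq0.
have [|| v [sv bv cv]] := red (rem w ws).
- exact: mem_rem.
- by rewrite mem_rem_uniq // inE eqxx.
(* The coefficient of [w] in [f] is 1, so [w] is congruent to minus the remaining terms; the summand
   [0] gives the shape of [supported_lin] and [bounded_lin]. *)
exists ((-1) *: v + 0); split.
- by apply: supported_lin => //; apply: supported0.
- by apply: bounded_lin => // i; rewrite mxE eqxx.
have := in_ideal_cat fI (in_ideal_ncmon (-1) [::] [::] cv); apply: in_ideal_eq => x.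
have fx : coef f x = coef [:: (1, w)] x + coef [seq (coef f y, y) | y <- rem w ws] x.
  rewrite fE -coef_cat /coef; apply: perm_big; rewrite /= -fw.
  by rewrite -(map_cons (fun y => (coef f y, y))); apply/perm_map/perm_to_rem.
rewrite !(coef_cat, coef_scale, coef_nfp_lin) fx.
have -> : coef (nfp m 0) x = 0.
  have := coef_nfp_lin m (-1) 0 0 x; rewrite scaler0 addr0 => ->; ring.
ring.
Qed.

(** The vector is picked by choice, but [nf_unique] shows that it does not depend on it. *)
Definition nf w : 'rV[K]_C := projT1 (cid (nf_exists w)).

Lemma nfP w : [/\ supported (wdeg d w) (nf w), bounded (wdeg d w) w (nf w)
  & cong R [:: (1, w)] (nfp (wdeg d w) (nf w))].
Proof. by rewrite /nf; case: cid. Qed.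

Lemma nf_unique w v : supported (wdeg d w) v ->
  cong R [:: (1, w)] (nfp (wdeg d w) v) -> nf w = v.
Proof.
move=> sv cv; have [sw _ cw] := nfP w; apply: (@nfp_cong (wdeg d w)) => //.
exact: cong_trans (cong_sym cw) cv.
Qed.

Lemma linext_supported m f : shom m f -> supported m (linext nf f).
Proof.
elim: f => [_|[c w] f IH /= /andP[/eqP wm fm]]; rewrite /linext.
  by rewrite big_nil; apply: supported0.
rewrite big_cons -/(linext nf f) /=; apply: supported_lin; last exact: IH.
by rewrite -wm; have [] := nfP w.
Qed.

Lemma cong_nfp m f : shom m f -> cong R f (nfp m (linext nf f)).
Proof.
elim: f => [_|[c w] f IH /= /andP[/eqP wm fm]]; rewrite /linext.
  apply: cong_eq => x; rewrite big_nil coef_nil.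
  have := coef_nfp_lin m (-1) 0 0 x; rewrite scaler0 addr0 => ->; ring.
rewrite big_cons -/(linext nf f) /=.
have [_ _ cw] := nfP w.
have := cong_cat (cong_ncmon c [::] [::] cw) (IH fm).
rewrite /= mulr1 cats0 /= => h; apply: cong_trans h _; apply: cong_eq => y.
by rewrite coef_cat coef_scale coef_nfp_lin wm.
Qed.

(** This turns membership in the ideal into linear algebra: a homogeneous element is congruent to
    its normal form, and a combination of normal words in the ideal is zero. *)
Lemma linext_nf0 m f : shom m f -> in_ideal R f <-> linext nf f = 0.
Proof.
move=> fm; have cf := cong_nfp fm; split=> [fI|f0].
  apply: (@nfp_ideal m); first exact: linext_supported.
  exact: cong_ideal (cong_sym cf) fI.
apply: cong_ideal cf _; apply: in_ideal0 => x; rewrite f0.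
have := coef_nfp_lin m (-1) 0 0 x; rewrite scaler0 addr0 => ->; ring.
Qed.

Lemma linext_nf_cong m f g : shom m f -> shom m g -> cong R f g ->
  linext nf f = linext nf g.
Proof.
move=> fm gm.
have h : shom m (f ++ ncmon (-1) [::] g [::]) by rewrite shom_cat fm shom_scale.
move/(linext_nf0 h); rewrite linext_cat linext_ncmon scaleN1r => /eqP; rewrite subr_eq0 => /eqP ->.
by apply: eq_linext => t _ /=; rewrite cats0.
Qed.

Lemma linext_nfp_nf m v : supported m v -> linext nf (nfp m v) = v.
Proof.
move=> sv; apply: (@nfp_cong m) => //; first exact/linext_supported/shom_nfp.
exact/cong_sym/cong_nfp/shom_nfp.
Qed.

(** * Matrices of right multiplication *)

Definition mulmat m a : 'M[K]_C :=
  \matrix_(i, j) (if (i < size (level (m - d a)%N))%N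
                  then nf (rcons (nth [::] (level (m - d a)%N) i) a) 0 j else 0).

(** Right multiplication by a word. Here [m] is the degree of the source, whereas in [mulmat] it is
    the degree of the target. *)
Fixpoint mulmatw m x : 'M[K]_C :=
  if x is a :: x' then mulmat (m + d a) a *m mulmatw (m + d a) x' else 1%:M.

(** The ideal is stable under right multiplication, so [u] may be replaced by its normal form before
    the letter is appended. *)
Lemma nf_rcons u a : nf (rcons u a) = nf u *m mulmat (wdeg d u + d a) a.
Proof.
have [su _ cu] := nfP u; set k := wdeg d u.
have := cong_ncmon 1 [::] [:: a] cu => /(@linext_nf_cong (k + d a)).
have ua : shom (k + d a) (ncmon 1 [::] [:: (1 : K, u)] [:: a]).
  by rewrite /shom /= cats1 wdeg_rcons eqxx.
have va : shom (k + d a) (ncmon 1 [::] (nfp k (nf u)) [:: a]).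
  have := shom_ncmon 1 [::] [:: a] (shom_nfp k (nf u)).
  by rewrite {2}/wdeg /= addn0.
move=> /(_ ua va); rewrite !linext_ncmon !scale1r linext_nfp /linext big_cons big_nil addr0 /=.
rewrite scale1r cats1 => ->.
apply/rowP => j; rewrite summxE mxE big_mkcond; apply: eq_bigr => i _.
rewrite !mxE addnK cats1; case: ifP => // im; by rewrite mulr0.
Qed.

Lemma nf_cat u x : nf (u ++ x) = nf u *m mulmatw (wdeg d u) x.
Proof.
elim: x u => [|a x IH] u /=; first by rewrite cats0 mulmx1.
by rewrite -cat_rcons IH nf_rcons wdeg_rcons mulmxA.
Qed.

(** * Invariance of normal forms under field endomorphisms *)

Section Frobenius.
Variable psi : {rmorphism K -> K}.
Hypothesis psi_R : forall r t, r \in R -> t \in r -> psi t.1 = t.1.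

Definition twist f : ncpoly K n := [seq (psi t.1, t.2) | t <- f].

Lemma coef_twist f w : coef (twist f) w = psi (coef f w).
Proof. by rewrite /coef big_map rmorph_sum. Qed.

Lemma in_ideal_twist f : in_ideal R f -> in_ideal R (twist f).
Proof.
move: f; apply: in_ideal_ind => [f g fg||f g|c u r v rR].
- by apply: in_ideal_eq => w; rewrite !coef_twist fg.
- exact: in_ideal_nil.
- by rewrite /twist map_cat; apply: in_ideal_cat.
have -> : twist (ncmon c u r v) = ncmon (psi c) u r v.
  rewrite /twist /ncmon -map_comp; apply/eq_in_map => t tr /=.
  by rewrite rmorphM (psi_R rR tr).
exact: in_ideal_mon.
Qed.

(* Normal forms are unique, so they are fixed by every field endomorphism that fixes the relations. *)
Lemma nf_fixed w i : psi (nf w 0 i) = nf w 0 i.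
Proof.
have [sw _ cw] := nfP w.
suff e : nf w = map_mx psi (nf w) by rewrite {2}e mxE.
apply: nf_unique; first by move=> j mj; rewrite mxE sw // rmorph0.
apply: in_ideal_eq (in_ideal_twist cw) => x.
rewrite coef_twist !coef_cat !coef_scale rmorphD rmorphM rmorphN1; congr (_ + _ * _).
  by rewrite !coef_mon; case: ifP; rewrite ?rmorph1 ?rmorph0.
rewrite -coef_twist /coef /twist /nfp -map_comp !big_map.
by apply: eq_big => [//|j _]; rewrite mxE.
Qed.

End Frobenius.

(** * Relations between the one-letter extensions of normal words *)

Definition butlast w := take (size w).-1 w.

Lemma butlast_rcons u a : butlast (rcons u a) = u.
Proof. by rewrite /butlast size_rcons -cats1 take_size_cat. Qed.

Lemma ends_rcons u a b : (rcons u b == rcons (butlast (rcons u b)) a) = (b == a).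
Proof. by rewrite butlast_rcons eqseq_rcons eqxx. Qed.

(** The value 1 for an empty relation keeps the degree positive in all cases. *)
Definition rdeg r := if r is t :: _ then wdeg d t.2 else 1%N.

Lemma rdegP r : r \in R -> (0 < rdeg r)%N /\ shom (rdeg r) r.
Proof. by move=> /R_shom[k k0]; case: r => //= t r /andP[/eqP-> rk]; rewrite eqxx. Qed.

(** Any common bound on the degrees of generators and relations would serve; the successor makes it
    positive, so that [D <= m] implies [0 < m]. *)
Definition window := (\max_a d a + \sum_(r <- R) rdeg r).+1.
Local Notation D := window.

Lemma d_window a : (d a <= D)%N.
Proof. by have : (d a <= \max_b d b)%N := leq_bigmax a; rewrite /window; lia. Qed.

Lemma rdeg_window r : r \in R -> (rdeg r <= D)%N.
Proof.
by move=> rR; rewrite /window (big_rem r) //=; lia.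
Qed.

(** The test on [butlast w] says that [w] ends in [a]. Writing the part of degree [m] of [f] as a
    sum of products [f_a a], for [m > 0], [rho m a f] is the class of [f_a] in [A_(m - d a)]. *)
Definition pre m a w : 'rV[K]_C :=
  if (wdeg d w == m) && (w == rcons (butlast w) a) then nf (butlast w) else 0.

Definition rho m a f := linext (pre m a) f.

(** If [r] is the sum of the products [r_a a], this is right multiplication by [r_a], from degree
    [m - rdeg r] to degree [m - d a]. *)
Definition relmat m r a : 'M[K]_C :=
  linext (fun w => if w == rcons (butlast w) a
                   then mulmatw (m - rdeg r) (butlast w) else 0) r.

(** The component at [a] of the left combination of the relations with coefficients [gam r].
    Repetitions are removed because [gam] assigns one coefficient to each relation as an element. *)
Definition relform m (gam : ncpoly K n -> 'rV[K]_C) a :=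
  \sum_(r <- undup R) gam r *m relmat m r a.

Lemma mulmx_linext (v : 'rV[K]_C) (phi : seq 'I_n -> 'M[K]_C) f :
  v *m linext phi f = linext (fun w => v *m phi w) f.
Proof.
by rewrite /linext mulmx_sumr; apply: eq_bigr => t _; rewrite scalemxAr.
Qed.

(** Deleting the last letter of [u x a] leaves [u x], whose normal form is that of [u] times the
    matrix of [x]. *)
Lemma rho_gen m c u r a : r \in R -> (wdeg d u + rdeg r)%N = m ->
  rho m a (ncmon c u r [::]) = (c *: nf u) *m relmat m r a.
Proof.
move=> rR um; have [r_gt0 /shomP rh] := rdegP rR.
rewrite /rho linext_ncmon -scalemxAl mulmx_linext; congr (_ *: _).
apply: eq_linext => t tr; have tdeg := rh _ tr.
rewrite cats0 /pre wdeg_cat tdeg um eqxx /=.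
case/lastP: (t.2) tdeg => [t0|x b _]; first by rewrite -t0 in r_gt0.
rewrite -rcons_cat !ends_rcons !butlast_rcons; case: eqP => _; last by rewrite mulmx0.
by rewrite nf_cat -um addnK.
Qed.

(** Deleting the final [b] from [u r v b] leaves [u r v], which is still in the ideal and has normal
    form zero. *)
Lemma rho_genr m c u r v b a : r \in R -> rho m a (ncmon c u r (rcons v b)) = 0.
Proof.
move=> rR; have [r_gt0 rh] := rdegP rR.
have fh := shom_ncmon c u (rcons v b) rh.
have [em|nem] := eqVneq (wdeg d u + rdeg r + wdeg d (rcons v b))%N m; last first.
  rewrite /rho /linext big1_seq // => t /andP[_ tr].
  by rewrite /pre (shomP _ _ fh _ tr) (negPf nem) scaler0.
have [ba|ba] := eqVneq b a; last first.
  rewrite /rho linext_ncmon /linext big1 ?scaler0 // => t _.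
  by rewrite /pre catA -rcons_cat ends_rcons (negPf ba) andbF scaler0.
have : linext nf (ncmon c u r v) = 0.
  by apply/(linext_nf0 (shom_ncmon c u v rh)); apply: in_ideal_mon.
rewrite /rho !linext_ncmon => <-; congr (_ *: _); apply: eq_linext => t tr.
rewrite /pre catA -rcons_cat ends_rcons ba eqxx butlast_rcons.
rewrite wdeg_rcons !wdeg_cat (shomP _ _ rh _ tr) -em wdeg_rcons ba.
by rewrite !addnA eqxx catA.
Qed.

(* A two-sided ideal is [I = F R + I S]: modulo [I S], which [rho] kills, an
   element of degree [m] of the ideal comes from a left multiple of the relations. *)
Lemma rho_ideal m f : in_ideal R f ->
  exists2 gam : ncpoly K n -> 'rV[K]_C,
    (forall r, supported (m - rdeg r) (gam r)) & forall a, rho m a f = relform m gam a.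
Proof.
have relform0 a : relform m (fun=> 0) a = 0.
  by rewrite /relform big1 // => r _; rewrite mul0mx.
have z (f' : ncpoly K n) : (forall a, rho m a f' = 0) ->
  exists2 gam : ncpoly K n -> 'rV[K]_C,
    (forall r, supported (m - rdeg r) (gam r)) & forall a, rho m a f' = relform m gam a.
  move=> h; exists (fun=> 0) => [r|a]; first exact: supported0.
  by rewrite h relform0.
move: f; apply: in_ideal_ind => [f g fg [gam sg hg]||f g [gam sg hg] [del sd hd]|c u r v rR].
- by exists gam => // a; rewrite -hg /rho; apply/esym/linext_eq.
- by apply: z => a; rewrite /rho /linext big_nil.
- exists (fun r => 1 *: gam r + del r) => [r|a]; first exact: supported_lin.
  rewrite /rho linext_cat -!/(rho _ _ _) hg hd /relform -big_split.
  by apply: eq_bigr => r _; rewrite scale1r mulmxDl.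
case/lastP: v => [|v b]; last by apply: z => a; apply: rho_genr.
have [em|nem] := eqVneq (wdeg d u + rdeg r)%N m; last first.
  apply: z => a; rewrite /rho /linext big1_seq // => t /andP[_ tr].
  have fh := shom_ncmon c u [::] (rdegP rR).2.
  by rewrite /pre (shomP _ _ fh _ tr) addn0 (negPf nem) scaler0.
exists (fun r' => if r' == r then c *: nf u else 0) => [r'|a].
  case: eqP => [->|_]; last exact: supported0.
  have [su _ _] := nfP u; rewrite -em addnK -[c *: _]addr0.
  by apply: supported_lin => //; apply: supported0.
rewrite (rho_gen _ _ rR em) /relform (bigD1_seq r) ?mem_undup ?undup_uniq //=.
rewrite eqxx big1 ?addr0 // => r' /negPf->; by rewrite mul0mx.
Qed.

(** If every component [f_a] is in the ideal, so is the sum of the products [f_a a], which is [f]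
    because positive degree excludes the empty word. *)
Lemma rho0_ideal m f : (0 < m)%N -> shom m f -> (forall a, rho m a f = 0) ->
  in_ideal R f.
Proof.
move=> m_gt0 fh f0.
have lastf t : t \in f -> exists x b, t.2 = rcons x b.
  move=> tf; have := shomP _ _ fh _ tf; case/lastP: (t.2) => [m0|x b _].
    by rewrite -m0 in m_gt0.
  by exists x, b.
pose fa a : ncpoly K n := [seq (t.1, butlast t.2) | t <- f & t.2 == rcons (butlast t.2) a].
have faI a : in_ideal R (fa a).
  have fah : shom (m - d a) (fa a).
    apply/shomP => t /mapP[t']; rewrite mem_filter => /andP[/eqP t'a t'f] -> /=.
    by have := shomP _ _ fh _ t'f; rewrite t'a butlast_rcons wdeg_rcons => <-; rewrite addnK.
  apply/(linext_nf0 fah); rewrite -(f0 a) /rho /linext big_map big_filter big_mkcond.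
  rewrite !big_seq; apply: eq_bigr => t tf; rewrite /pre (shomP _ _ fh _ tf) eqxx /=.
  by case: ifP => //; rewrite scaler0.
have gI : in_ideal R (flatten [seq ncmon 1 [::] (fa a) [:: a] | a <- enum 'I_n]).
  by apply: in_ideal_flatten => a _; apply: in_ideal_ncmon.
apply: in_ideal_eq gI => w; rewrite coef_flatten big_enum /=.
transitivity (\sum_a \sum_(t <- f | (t.2 == rcons (butlast t.2) a) && (t.2 == w)) t.1).
  apply: eq_bigr => a _; rewrite /coef !big_map big_filter_cond /=.
  rewrite [LHS](eq_bigr (fun t => t.1)); last by move=> t _; rewrite mul1r.
  apply: eq_bigl => t; rewrite cats1.
  by case: eqP => //= ta; rewrite -ta.
rewrite (exchange_big_dep (fun t => t.2 == w)) => [|a t _ /andP[]//].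
rewrite /coef big_seq_cond [RHS]big_seq_cond; apply: eq_bigr => t /andP[tf tw].
have [x [b tb]] := lastf _ tf.
rewrite (big_pred1 b) // => a; rewrite tw andbT tb ends_rcons /= eq_sym //.
Qed.

(** A lift to the free algebra of an element of the direct sum of the [A_(m - d a)]: each component,
    in normal form, is followed by its letter. *)
Definition cpoly m (c : 'I_n -> 'rV[K]_C) : ncpoly K n :=
  flatten [seq ncmon 1 [::] (nfp (m - d a) (c a)) [:: a] | a <- enum 'I_n].

Lemma coef_cpoly_rcons m c u a :
  coef (cpoly m c) (rcons u a) = coef (nfp (m - d a) (c a)) u.
Proof.
rewrite coef_flatten big_enum /= (bigD1 a) //= coef_rcons big1 ?addr0 // => b ba.
apply/eqP; apply: contraR ba => /coef_rcons_neq0[x /rcons_inj[_ ->]] _.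
by rewrite eqxx.
Qed.

Lemma coef_cpoly_nil m c : coef (cpoly m c) [::] = 0.
Proof.
rewrite coef_flatten big1 // => b _; apply/eqP/negPn/negP.
by move/coef_rcons_neq0 => [[|x u]].
Qed.

Lemma shom_cpoly m c : (D <= m)%N -> shom m (cpoly m c).
Proof.
move=> Dm; apply/shomP => t /flatten_mapP[a _].
have /(shom_ncmon 1 [::] [:: a])/shomP h := shom_nfp (m - d a) (c a).
by move/h ->; rewrite /wdeg /= addn0 subnK // (leq_trans (d_window a)).
Qed.

Lemma rho_cpoly m c a : (D <= m)%N -> supported (m - d a) (c a) ->
  rho m a (cpoly m c) = c a.
Proof.
move=> Dm sc; rewrite /rho linext_flatten big_enum /= (bigD1 a) //= big1 ?addr0.
  rewrite linext_ncmon scale1r -[RHS](linext_nfp_nf sc); apply: eq_linext => t tn.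
  rewrite /pre /= cats1 ends_rcons butlast_rcons eqxx wdeg_rcons.
  by rewrite (shomP _ _ (shom_nfp _ _) _ tn) subnK ?eqxx // (leq_trans (d_window a)).
move=> b /negPf ba; rewrite linext_ncmon scale1r /linext big1 // => t _.
by rewrite /pre /= cats1 ends_rcons ba andbF scaler0.
Qed.

(** Membership in the image of the map from the sum of the [A_(m - rdeg r)] to the sum of the
    [A_(m - d a)]; for [m >= D] its cokernel is [A_m]. It refers only to degrees below [m]. *)
Definition relation m (c : 'I_n -> 'rV[K]_C) :=
  exists2 gam : ncpoly K n -> 'rV[K]_C,
    {in R, forall r, supported (m - rdeg r) (gam r)} & forall a, c a = relform m gam a.

(** One direction is [rho_ideal]. For the other, [gam] is lifted to a left combination [g] of the
    relations; [rho] kills the difference of [cpoly m c] and [g], which is therefore in the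
    ideal. *)
Lemma relationP m c : (D <= m)%N -> (forall a, supported (m - d a) (c a)) ->
  in_ideal R (cpoly m c) <-> relation m c.
Proof.
move=> Dm sc; split=> [/(rho_ideal m)[gam sg hg]|[gam sg hg]].
  by exists gam => [r _ //|a]; rewrite -hg rho_cpoly.
pose grow r : ncpoly K n :=
  flatten [seq ncmon (gam r 0 i) (nth [::] (level (m - rdeg r)) i) r [::]
            | i : 'I_C <- enum 'I_C & (i < size (level (m - rdeg r)))%N].
pose g : ncpoly K n := flatten [seq grow r | r <- undup R].
have gI : in_ideal R g.
  apply: in_ideal_flatten => r; rewrite mem_undup => rR.
  by apply: in_ideal_flatten => i _; apply: in_ideal_mon.
have m_gt0 : (0 < m)%N by apply: leq_trans Dm.
have rm r : r \in R -> (rdeg r <= m)%N by move=> rR; apply: leq_trans (rdeg_window rR) Dm.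
have gh : shom m g.
  apply/shomP => t /flatten_mapP[r]; rewrite mem_undup => rR /flatten_mapP[i].
  rewrite mem_filter => /andP[im _]; have [_ /(shom_ncmon (gam r 0 i))rh] := rdegP rR.
  move/(shomP _ _ (rh _ _)) ->; rewrite wdeg_nth_level // addn0 subnK //; exact: rm.
have rg a : rho m a g = relform m gam a.
  rewrite /rho /g linext_flatten /relform !big_seq; apply: eq_bigr => r.
  rewrite mem_undup => rR; rewrite linext_flatten big_filter big_enum_cond /=.
  rewrite -{2}(linext_nfp_nf (sg _ rR)) linext_nfp mulmx_suml.
  apply: eq_bigr => i im; rewrite -/(rho _ _ _) rho_gen // wdeg_nth_level // subnK //.
  exact: rm.
have hI : in_ideal R (cpoly m c ++ ncmon (-1) [::] g [::]).
  apply: (rho0_ideal m_gt0); first by rewrite shom_cat shom_cpoly // shom_scale.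
  move=> a; rewrite /rho linext_cat linext_ncmon -/(rho _ _ _) rho_cpoly // hg -rg.
  rewrite scaleN1r; apply/eqP; rewrite subr_eq0; apply/eqP/eq_linext => t _.
  by rewrite cats0.
exact: cong_ideal hI gI.
Qed.

(** * Normality and normal forms of one-letter extensions *)

Definition valid m (x : 'I_n * 'I_C) :=
  (d x.1 <= m)%N && (x.2 < size (level (m - d x.1)%N))%N.

Lemma coef_cpoly_cword m c x : valid m x -> coef (cpoly m c) (cword m x) = c x.1 0 x.2.
Proof. by case/andP=> _ xs; rewrite coef_cpoly_rcons coef_nfp. Qed.

Lemma coef_cpoly_neq0 m c w : (D <= m)%N -> coef (cpoly m c) w != 0 ->
  exists2 x, valid m x & w = cword m x.
Proof.
move=> Dm; case/lastP: w => [|u a]; first by rewrite coef_cpoly_nil eqxx.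
rewrite coef_cpoly_rcons => /coef_nfp_neq0[i im ->]; exists (a, i) => //.
by rewrite /valid im (leq_trans (d_window a)).
Qed.

Lemma wdeg_cword m x : valid m x -> wdeg d (cword m x) = m.
Proof. by case/andP=> xm xs; rewrite wdeg_rcons wdeg_nth_level // subnK. Qed.

Lemma cword_inj m : {in valid m &, injective (cword m)}.
Proof.
move=> [a i] [b j] /andP[/= am im] /andP[/= _ jm].
rewrite /cword /cword_of /= => /rcons_inj[e ab]; move: jm e; rewrite -ab => jm e.
congr (_, _); apply/val_inj/eqP.
by rewrite /= -(nth_uniq [::] im jm (level_uniq _)) e.
Qed.

Lemma parents_valid m x : x \in parents m -> valid m x.
Proof. by rewrite mem_parents /valid => /and3P[-> ->]. Qed.

Lemma valid_parents m x : valid m x -> (x \in parents m) = `[< normal (cword m x) >].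
Proof. by rewrite mem_parents /valid => /andP[-> ->]. Qed.

Lemma size_parents m : (0 < m)%N -> size (parents m) = size (level m).
Proof. by move=> m0; rewrite levelE // size_map. Qed.

Lemma index_parents m x : x \in parents m -> (index x (parents m) < C)%N.
Proof.
case: (posnP m) => [->|m0 xP].
  by rewrite mem_parents leqn0 => /andP[/eqP e _]; have := d_pos x.1; rewrite e.
by apply: leq_trans (size_level m); rewrite -size_parents // index_mem.
Qed.

Lemma nth_index_parents m x : (0 < m)%N -> x \in parents m ->
  nth [::] (level m) (index x (parents m)) = cword m x.
Proof.
move=> m0 xP; rewrite levelE // (nth_map x) ?index_mem //.
by rewrite nth_index.
Qed.

(** A change of index: the rank of a normal word of degree [m] is the position of its pair in
    [parents m], so a vector over the level becomes one over pairs (letter, rank). *)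
Definition onparents m (v : 'rV[K]_C) a : 'rV[K]_C :=
  \row_i (if (a, i) \in parents m then v 0 (inord (index (a, i) (parents m))) else 0).

(** The coordinates of [cword m x] minus [v] on the one-letter extensions of normal words, as
    [coef_candrel] shows; it is a relation exactly when [v] is the normal form. *)
Definition candrel m x v a : 'rV[K]_C :=
  (-1) *: onparents m v a + (if a == x.1 then delta_mx 0 x.2 else 0).

Lemma candrelE m x v y : candrel m x v y.1 0 y.2 =
  - (if y \in parents m then v 0 (inord (index y (parents m))) else 0) + (y == x)%:R.
Proof.
case: y => a i; rewrite !mxE mulN1r; congr (_ + _).
rewrite [in RHS]/eq_op /=; case: eqP => _ /=; last by rewrite mxE.
by rewrite mxE eqxx.
Qed.

Lemma candrel_supported m x v a : (D <= m)%N -> valid m x -> supported (m - d a) (candrel m x v a).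
Proof.
move=> Dm xv i im; have := candrelE m x v (a, i) => /= ->.
have nv : ~~ valid m (a, i) by rewrite /valid /= (ltnNge i) im andbF.
rewrite ifN ?oppr0 ?add0r; last by apply: contra nv => /parents_valid.
by case: eqP nv => // ->; rewrite xv.
Qed.

Lemma coef_candrel m x v w : (D <= m)%N -> valid m x ->
  coef (cpoly m (candrel m x v)) w = coef [:: (1, cword m x)] w - coef (nfp m v) w.
Proof.
move=> Dm xv; have m_gt0 : (0 < m)%N by apply: leq_trans Dm.
rewrite coef_mon; have [[y yv ->]|nw] := EM (exists2 y, valid m y & w = cword m y).
  rewrite coef_cpoly_cword // candrelE (inj_in_eq (@cword_inj m)) // addrC eq_sym.
  congr (_ - _); first by case: ifP.
  case: ifP => yP.
    rewrite -nth_index_parents // -[in RHS](inordK (index_parents yP)) coef_nfp //.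
    by rewrite inordK ?index_parents // -size_parents // index_mem.
  apply/esym/eqP; apply: contraFT yP => /coef_nfp_neq0[i im e].
  rewrite valid_parents // e; apply/asboolP.
  by have /mem_level[] := mem_nth [::] im.
have -> : coef (cpoly m (candrel m x v)) w = 0.
  by apply/eqP/negPn/negP => /(coef_cpoly_neq0 Dm) h; apply: nw.
case: eqP => [e|_]; first by case: nw; exists x.
rewrite sub0r; apply/esym/eqP; rewrite oppr_eq0; apply/negPn/negP.
move=> /coef_nfp_neq0[i im e]; apply: nw.
move: (mem_nth [::] im); rewrite -e levelE // => /mapP[y yP ->].
by exists y => //; apply: parents_valid.
Qed.

(** Together with [nonnormal_cword] this determines degree [m] from smaller degrees: given
    [parents m], the condition on [v] involves only earlier data. *)
Lemma candrelP m x v : (D <= m)%N -> valid m x -> supported m v ->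
  nf (cword m x) = v <-> relation m (candrel m x v).
Proof.
move=> Dm xv sv; rewrite -relationP //; last by move=> a; apply: candrel_supported.
have wm := wdeg_cword xv.
have e : coef ([:: (1, cword m x)] ++ ncmon (-1) [::] (nfp m v) [::]) =1
         coef (cpoly m (candrel m x v)).
  by move=> w; rewrite coef_candrel // coef_cat coef_scale; ring.
split=> [<-|h].
  have [_ _] := nfP (cword m x); rewrite wm; apply: in_ideal_eq => w.
  by rewrite coef_candrel // coef_cat coef_scale; ring.
apply: nf_unique; rewrite wm //; apply: in_ideal_eq h => w; by rewrite -e.
Qed.

(** An extension fails to be normal exactly when it is the leading word of a relation between
    extensions. Such a relation is the extension minus its normal form, which involves only normal
    words that are not larger. *)
Lemma nonnormal_cword m x : (D <= m)%N -> valid m x ->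
  ~ normal (cword m x) <->
  exists c, [/\ forall a, supported (m - d a) (c a), relation m c, c x.1 0 x.2 != 0
    & forall y, c y.1 0 y.2 != 0 -> y = x \/ lexlt s (cword m y) (cword m x)].
Proof.
move=> Dm xv; split=> [nx|[c [sc rc cx clt]]].
  have [sv bv cv] := nfP (cword m x); rewrite wdeg_cword // in sv bv.
  exists (candrel m x (nf (cword m x))); split.
  - by move=> a; apply: candrel_supported.
  - exact/candrelP.
  - rewrite candrelE eqxx valid_parents //.
    by case: asboolP => // _; rewrite oppr0 add0r oner_neq0.
  move=> y; rewrite candrelE; have [->|_] := eqVneq y x; first by left.
  rewrite addr0 oppr_eq0; case: ifP => [yP|]; last by rewrite eqxx.
  move/bv; rewrite inordK ?index_parents // nth_index_parents //; last exact: leq_trans Dm.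
  case/orP => [/eqP e|]; last by right.
  by case: nx; rewrite -e; move: yP; rewrite mem_parents => /and3P[_ _ /asboolP].
move/(_ _)=> nx; apply: nx; exists (cpoly m c).
split; first exact/relationP.
split; first by rewrite coef_cpoly_cword.
move=> w cw; have [y yv wE] := coef_cpoly_neq0 Dm cw.
move: cw; rewrite wE coef_cpoly_cword // => /clt[->|yx]; first by left.
by right; rewrite /deglex_lt !wdeg_cword // ltnn eqxx.
Qed.

(** * Eventual periodicity *)

(* The guards make the junk default values of [nth] irrelevant. *)
Definition tab m m' (i : nat) a (j : nat) b :=
  [&& (i < size (level m))%N, (j < size (level m'))%N
    & lexlt s (rcons (nth [::] (level m) i) a) (rcons (nth [::] (level m') j) b)].

(** The condition [0 < k] leaves out the degrees [m] and [m'] themselves: agreement there is to be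
    deduced from the windows below. *)
Definition agree m m' := forall k, (0 < k <= D)%N ->
  [/\ size (level (m - k)) = size (level (m' - k)), mulmat (m - k) =1 mulmat (m' - k)
    & forall l, (0 < l <= D)%N -> forall i a j b,
        tab (m - k) (m - l) i a j b = tab (m' - k) (m' - l) i a j b].

Lemma agree_sym m m' : agree m m' -> agree m' m.
Proof.
move=> h k kD; have [e1 e2 e3] := h k kD; split; first by rewrite e1.
  by move=> a; rewrite e2.
by move=> l lD i a j b; rewrite e3.
Qed.

Lemma mulmatw_eq k k' x :
  (forall e, (0 < e <= wdeg d x)%N -> mulmat (k + e) =1 mulmat (k' + e)) ->
  mulmatw k x = mulmatw k' x.
Proof.
elim: x k k' => //= a x IH k k' h; have := d_pos a.
rewrite {1}/wdeg /= -/(wdeg d x) in h * => a0.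
congr (_ *m _); first by apply: h; rewrite a0 leq_addr.
by apply: IH => e e_le b; rewrite -!addnA; apply: h; lia.
Qed.

Lemma supported_eq m m' v :
  size (level m) = size (level m') -> supported m v -> supported m' v.
Proof. by move=> e h i; rewrite -e; apply: h. Qed.

Section Step.
Variables m m' : nat.
Hypotheses (Dm : (D <= m)%N) (Dm' : (D <= m')%N) (mm' : agree m m').

Lemma d_range a : (0 < d a <= D)%N.
Proof. by rewrite d_pos d_window. Qed.

Lemma relmat_agree r a : r \in R -> relmat m r a = relmat m' r a.
Proof.
move=> rR; have [r_gt0 /shomP rh] := rdegP rR; have rD := rdeg_window rR.
apply: eq_linext => t /rh; case/lastP: (t.2) => // x b.
rewrite butlast_rcons wdeg_rcons => tdeg; case: eqP => // _.
(* The deleted last letter has positive degree, so every degree met by [mulmatw] lies in the window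
   strictly below [m]. *)
apply: mulmatw_eq => e e_le c; have b0 := d_pos b.
have -> : (m - rdeg r + e = m - (rdeg r - e))%N by lia.
have -> : (m' - rdeg r + e = m' - (rdeg r - e))%N by lia.
have ke : (0 < rdeg r - e <= D)%N by lia.
by have [_ -> _] := mm' ke.
Qed.

Lemma relation_agree c : relation m c -> relation m' c.
Proof.
case=> gam sg hg; exists gam => [r rR|a].
  have [r_gt0 _] := rdegP rR; have rD := rdeg_window rR.
  have [|e _ _] := mm' (k := rdeg r); first by rewrite r_gt0 rD.
  exact: supported_eq e (sg _ rR).
rewrite hg /relform !big_seq; apply: eq_bigr => r; rewrite mem_undup => rR.
by rewrite relmat_agree.
Qed.

Lemma valid_agree x : valid m x = valid m' x.
Proof.
rewrite /valid; have [-> _ _] := mm' (d_range x.1).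
by rewrite !(leq_trans (d_window x.1)).
Qed.

Lemma lexlt_cwordE k x y : valid k x -> valid k y ->
  lexlt s (cword k x) (cword k y) = tab (k - d x.1) (k - d y.1) x.2 x.1 y.2 y.1.
Proof. by case/andP=> _ xs /andP[_ ys]; rewrite /tab xs ys. Qed.

(** The same coefficients [c] form a relation in degree [m'], and the comparison tables give it the
    same leading pair. *)
Lemma nonnormal_agree x : valid m x -> ~ normal (cword m x) -> ~ normal (cword m' x).
Proof.
move=> xv /(nonnormal_cword Dm xv)[c [sc rc cx clt]].
have xv' : valid m' x by rewrite -valid_agree.
apply/(nonnormal_cword Dm' xv'); exists c; split=> // [a||y cy].
- by have [e _ _] := mm' (d_range a); apply: supported_eq e (sc a).
- exact: relation_agree.
have yv : valid m y.
  rewrite /valid (leq_trans (d_window y.1)) //= ltnNge; apply: contra cy => ys.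
  by rewrite sc.
have yv' : valid m' y by rewrite -valid_agree.
case: (clt _ cy) => [->|]; first by left.
rewrite !lexlt_cwordE //; have [_ _ ->] := mm' (d_range y.1); last exact: d_range.
by right.
Qed.

End Step.

Lemma parents_agree m m' : (D <= m)%N -> (D <= m')%N -> agree m m' ->
  parents m = parents m'.
Proof.
move=> Dm Dm' mm'; rewrite /parents /parents_of; apply: eq_in_filter => x _.
rewrite -/(cword m x) -/(cword m' x) !andbA -/(valid m x) -/(valid m' x).
have ve := valid_agree Dm Dm' mm' x; rewrite -ve.
case xv: (valid m x) => //=; rewrite ve in xv.
apply: asbool_equiv_eq; split; apply: contraPP.
  exact: (nonnormal_agree Dm' Dm (agree_sym mm')).
by apply: (nonnormal_agree Dm Dm' mm'); rewrite ve.
Qed.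

(** The normal form of an extension in degree [m] gives a relation, which remains one in degree
    [m']; uniqueness of normal forms does the rest. *)
Lemma mulmat_agree m m' : (D <= m)%N -> (D <= m')%N -> agree m m' ->
  mulmat m =1 mulmat m'.
Proof.
move=> Dm Dm' mm' a; apply/matrixP => i j; rewrite !mxE.
have [e _ _] := mm' _ (d_range a); rewrite -e; case: ifP => // im.
have xv : valid m (a, i) by rewrite /valid /= im (leq_trans (d_window a)).
have xv' : valid m' (a, i) by rewrite -(valid_agree Dm Dm' mm').
have pe := parents_agree Dm Dm' mm'.
have szl : size (level m) = size (level m').
  by rewrite -!size_parents ?pe //; [apply: leq_trans Dm' | apply: leq_trans Dm].
have [sv _ _] := nfP (cword m (a, i)); rewrite wdeg_cword // in sv.
have /(candrelP Dm xv sv)/(relation_agree Dm Dm' mm') := erefl (nf (cword m (a, i))).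
have -> : candrel m (a, i) (nf (cword m (a, i))) = candrel m' (a, i) (nf (cword m (a, i))).
  by rewrite /candrel /onparents pe.
by move/(candrelP Dm' xv' (supported_eq szl sv)) => ->.
Qed.

Lemma nth_level_parent m i x0 : (0 < m)%N -> (i < size (level m))%N ->
  let x := nth x0 (parents m) i in valid m x /\ nth [::] (level m) i = cword m x.
Proof.
move=> m0 im x; have iP : (i < size (parents m))%N by rewrite size_parents.
split; first exact/parents_valid/mem_nth.
by rewrite levelE // (nth_map x0).
Qed.

(** The left word without [a] has larger degree than the right word without [b], so [a] is
    irrelevant by [lexlt_rconsl]; what remains is an extension of an earlier normal word. *)
Lemma tab_newl m l i a j b x0 : (0 < l <= m)%N -> (i < size (level m))%N ->
  tab m (m - l) i a j b =
  let x := nth x0 (parents m) i in tab (m - d x.1) (m - l) x.2 x.1 j b.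
Proof.
move=> lm im; have [|] := nth_level_parent x0 _ im; first by lia.
set x := nth _ _ _ => /andP[xm xs] ie; rewrite /= /tab im xs.
have [jm|] //= := ltnP j (size (level (m - l))).
rewrite (lexlt_rconsl s d_pos).
- by rewrite {1}ie.
- by rewrite !wdeg_nth_level //; lia.
by apply/eqP => /(congr1 (wdeg d)); rewrite !wdeg_nth_level //; lia.
Qed.

Lemma tab_newr m l i a j b : (0 < l <= m)%N -> (i < size (level (m - l)))%N ->
  (j < size (level m))%N -> tab (m - l) m i a j b = ~~ tab m (m - l) j b i a.
Proof.
move=> lm im jm; rewrite /tab im jm /= (lexlt_total s_inj) //.
rewrite eqseq_rcons negb_and; apply/orP; left.
by apply/eqP => /(congr1 (wdeg d)); rewrite !wdeg_nth_level //; lia.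
Qed.

Lemma tab_new m i a j b x0 : (0 < m)%N -> (i < size (level m))%N ->
  (j < size (level m))%N -> tab m m i a j b =
  if i == j then (s a < s b)%N else
  let x := nth x0 (parents m) i in let y := nth x0 (parents m) j in
  tab (m - d x.1) (m - d y.1) x.2 x.1 y.2 y.1.
Proof.
move=> m0 im jm; have [xv ie] := nth_level_parent x0 m0 im.
have [yv je] := nth_level_parent x0 m0 jm; rewrite {1}/tab im jm /=.
have [->|ij] := eqVneq i j; first by rewrite lexlt_rcons2.
rewrite (lexlt_rcons_eqdeg s d_pos) ?wdeg_nth_level ?nth_uniq ?level_uniq //.
by rewrite ie je lexlt_cwordE.
Qed.

(** Only the degrees [m] and [m'] enter the windows. Their parents and matrices agree by the
    previous lemmas, and their comparisons reduce to older ones by [tab_newl], [tab_newr] and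
    [tab_new]. *)
Lemma agreeS m m' : (D <= m)%N -> (D <= m')%N -> agree m m' -> agree m.+1 m'.+1.
Proof.
move=> Dm Dm' mm'.
have m0 : (0 < m)%N by apply: leq_trans Dm.
have m0' : (0 < m')%N by apply: leq_trans Dm'.
have pe := parents_agree Dm Dm' mm'.
have szl : size (level m) = size (level m') by rewrite -!size_parents ?pe.
have tl l i a j b : (0 < l <= D)%N -> tab m (m - l) i a j b = tab m' (m' - l) i a j b.
  move=> lD; have [im|im] := ltnP i (size (level m)); last first.
    by rewrite /tab -szl ltnNge im.
  have [x0 _] : exists x0, x0 \in parents m.
    by move: im; rewrite -size_parents //; case: (parents m) => // x0 p; exists x0; rewrite mem_head.
  rewrite (tab_newl _ _ _ x0 _ im); last by lia.
  rewrite (@tab_newl m' l i a j b x0) -?szl //; last by lia.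
  rewrite /= pe; have [_ _ -> //] := mm' _ (d_range (nth x0 (parents m') i).1).
have tr l i a j b : (0 < l <= D)%N -> tab (m - l) m i a j b = tab (m' - l) m' i a j b.
  move=> lD; have [szk _ _] := mm' _ lD.
  have [im|im] := ltnP i (size (level (m - l))); last by rewrite /tab -szk ltnNge im.
  have [jm|jm] := ltnP j (size (level m)); last first.
    by rewrite /tab -szl (ltnNge j) jm !andbF.
  by rewrite !tab_newr -?szk -?szl ?tl //; lia.
have tn i a j b : tab m m i a j b = tab m' m' i a j b.
  have [im|im] := ltnP i (size (level m)); last by rewrite /tab -szl ltnNge im.
  have [jm|jm] := ltnP j (size (level m)); last first.
    by rewrite /tab -szl (ltnNge j) jm !andbF.
  have [x0 _] : exists x0, x0 \in parents m.
    by move: im; rewrite -size_parents //; case: (parents m) => // x0 p; exists x0; rewrite mem_head.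
  rewrite (tab_new _ _ x0) // (@tab_new m' i a j b x0) -?szl //; case: eqP => // _.
  rewrite /= pe; have [_ _ ->] := mm' _ (d_range (nth x0 (parents m') i).1) => //.
  exact: d_range.
(* Distance 1 is the new degree; a larger distance is one less in the old window. *)
move=> [//|[|k]] kD.
  rewrite !subn1 /=; split=> //; first exact: mulmat_agree.
  move=> [//|[|l]] lD i a j b; first by rewrite !subn1; apply: tn.
  by rewrite !subSS; apply: tl; lia.
have kD' : (0 < k.+1 <= D)%N by lia.
rewrite !subSS; have [e1 e2 e3] := mm' _ kD'; split=> //.
move=> [//|[|l]] lD i a j b; first by rewrite !subn1 /=; apply: tr.
by rewrite !subSS; apply: e3; lia.
Qed.

Section Periodicity.
Variables (psi : {rmorphism K -> K}) (E : seq K).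
Hypotheses (psi_R : forall r t, r \in R -> t \in r -> psi t.1 = t.1)
  (psi_E : forall c, psi c = c -> c \in E).

Lemma mulmat_E m a i j : mulmat m a i j \in E.
Proof.
apply: psi_E; rewrite mxE; case: ifP => _; last exact: rmorph0.
exact: nf_fixed.
Qed.

(** Matrix entries are recorded by their positions in [E], which makes the type of states finite
    even when [K] is infinite. *)
Definition state m :=
  ([ffun k : 'I_D.+1 => inord (size (level (m - k))) : 'I_C.+1],
   [ffun x : 'I_D.+1 * 'I_n * 'I_C * 'I_C =>
      inord (index (mulmat (m - x.1.1.1) x.1.1.2 x.1.2 x.2) E) : 'I_(size E).+1],
   [ffun x : 'I_D.+1 * 'I_D.+1 * ('I_C * 'I_n) * ('I_C * 'I_n) =>
      tab (m - x.1.1.1) (m - x.1.1.2) x.1.2.1 x.1.2.2 x.2.1 x.2.2]).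

Lemma state_agree m m' : state m = state m' -> agree m m'.
Proof.
case=> /ffunP e1 /ffunP e2 /ffunP e3 k kD.
have kD1 : (k < D.+1)%N by lia.
have szk : size (level (m - k)) = size (level (m' - k)).
  have := e1 (Ordinal kD1); rewrite !ffunE => /(congr1 val).
  by rewrite /= !inordK // ltnS size_level.
split=> //.
  move=> a; apply/matrixP => i j.
  have := e2 (Ordinal kD1, a, i, j); rewrite !ffunE => /(congr1 val) /=.
  rewrite !inordK ?ltnS ?index_size // => e.
  by rewrite -[LHS](nth_index 0 (mulmat_E _ _ _ _)) e nth_index // mulmat_E.
move=> l lD i a j b; have lD1 : (l < D.+1)%N by lia.
have [iC|iC] := ltnP i C; last first.
  by rewrite /tab !(ltnNge i) !(leq_trans (size_level _) iC).
have [jC|jC] := ltnP j C; last first.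
  by rewrite /tab !(ltnNge j) !(leq_trans (size_level _) jC) !andbF.
by have := e3 (Ordinal kD1, Ordinal lD1, (Ordinal iC, a), (Ordinal jC, b)); rewrite !ffunE.
Qed.

(** Two states coincide by the pigeonhole principle, and [agreeS] propagates the agreement to all
    later degrees. *)
Lemma parents_periodic : exists m0 p, [/\ (0 < m0)%N, (0 < p)%N
  & forall m, (m0 <= m)%N -> parents (m + p) = parents m].
Proof.
have [i [j [ij eij]]] : exists i j, (i < j)%N /\ state (D + i) = state (D + j).
  pose T := prod (prod {ffun 'I_D.+1 -> 'I_C.+1}
     {ffun 'I_D.+1 * 'I_n * 'I_C * 'I_C -> 'I_(size E).+1})
     {ffun 'I_D.+1 * 'I_D.+1 * ('I_C * 'I_n) * ('I_C * 'I_n) -> bool}.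
  pose F (i : 'I_(#|{: T}|.+1)) : T := state (D + i).
  have /injectivePn[i [j ij eij]] : ~~ injectiveb F.
    apply/injectiveP => /leq_card; by rewrite card_ord ltnn.
  case: (ltngtP i j) => h; [by exists i, j | by exists j, i |].
  by move: ij; rewrite (val_inj h) eqxx.
exists (D + i)%N, (j - i)%N; split; [by [] | lia |].
have ag k : agree (D + i + k) (D + j + k).
  elim: k => [|k IH]; first by rewrite !addn0; apply: state_agree.
  by rewrite !addnS; apply: agreeS => //; lia.
move=> m mi; have := ag (m - (D + i))%N.
have -> : (D + i + (m - (D + i)) = m)%N by lia.
have -> : (D + j + (m - (D + i)) = m + (j - i))%N by lia.
by move/parents_agree => -> //; lia.
Qed.

End Periodicity.

(** * Hilbert series and automaton *)

Lemma linext_hpart m f :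
  linext (fun w => if wdeg d w == m then nf w else 0) f = linext nf (hpart m f).
Proof.
rewrite /linext /hpart big_filter [RHS]big_mkcond; apply: eq_bigr => t _.
by case: ifP => // _; rewrite scaler0.
Qed.

Lemma linext_lincomb (V : lmodType K) (phi : seq 'I_n -> V) (cs : seq K) fs :
  linext phi (lincomb cs fs) = \sum_(x <- zip cs fs) x.1 *: linext phi x.2.
Proof.
rewrite /lincomb linext_flatten; apply: eq_bigr => x _.
rewrite /linext big_map scaler_sumr; apply: eq_bigr => t _ /=.
by rewrite scalerA.
Qed.

Lemma graded_dim_level m : graded_dim d R m (size (level m)).
Proof.
split.
  exists [seq [:: (1, x)] | x <- level m]; rewrite size_map; split=> //.
  by apply: indep_normal (level_uniq m) _ => w /mem_level.
move=> fs [fsh fsi]; rewrite leqNgt; apply/negP => szlt.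
pose phi w := if wdeg d w == m then nf w else 0.
pose B : 'M[K]_(size fs, size (level m)) :=
  \matrix_(j, i) linext phi (nth [::] fs j) 0 (inord i).
have sphi f : supported m (linext phi f).
  by rewrite linext_hpart; apply/linext_supported/shom_hpart.
(* There are more rows than columns, so some nontrivial combination of [fs] has normal form zero;
   independence will force its coefficients to vanish. *)
have : kermx B != 0.
  by rewrite kermx_eq0 /row_free neq_ltn (leq_ltn_trans (rank_leq_col B)).
case/rowV0Pn => u /sub_kermxP uB /negP; apply.
pose cs := [seq u 0 j | j <- enum 'I_(size fs)].
have zE : zip cs fs = [seq (u 0 j, nth [::] fs j) | j <- enum 'I_(size fs)].
  rewrite -zip_map; congr zip; rewrite -[LHS](mkseq_nth [::]) /mkseq -val_enum_ord.
  by rewrite -map_comp.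
have lin0 : linext phi (lincomb cs fs) = 0.
  rewrite linext_lincomb zE big_map big_enum /=; apply/rowP => i; rewrite summxE mxE.
  have [im|im] := ltnP i (size (level m)); last first.
    by rewrite big1 // => j _; rewrite mxE sphi // mulr0.
  have /rowP/(_ (Ordinal im)) := uB; rewrite !mxE => uBi.
  rewrite -[RHS]uBi; apply: eq_bigr => j _; by rewrite !mxE /= inord_val.
have linh : homog_of_deg d (lincomb cs fs) m.
  move=> w; rewrite coef_linext linext_lincomb => h.
  have [/hasP[x xz xw]|/hasPn none] := boolP (has (fun x => coef x.2 w != 0) (zip cs fs)).
    apply: fsh xw; move: xz; rewrite zE => /mapP[j _ ->].
    exact: mem_nth.
  move: h; rewrite big1_seq ?eqxx // => x /none; rewrite negbK -coef_linext => /eqP ->.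
  by rewrite scaler0.
have linI : in_ideal R (lincomb cs fs).
  apply: (@in_ideal_eq _ _ _ (hpart m (lincomb cs fs))).
    by move=> w; rewrite (hpart_homog linh).
  by apply/(linext_nf0 (shom_hpart _ _)); rewrite -linext_hpart.
have szcs : size cs = size fs by rewrite size_map size_enum_ord.
apply/eqP/rowP => j; rewrite [RHS]mxE; apply: (fsi cs szcs linI).
by apply: map_f; rewrite mem_enum.
Qed.

Section Automaton.
Variables m0 p : nat.
Hypotheses (m0_gt0 : (0 < m0)%N) (p_gt0 : (0 < p)%N)
  (per : forall m, (m0 <= m)%N -> parents (m + p) = parents m).

Lemma parents_per k j : (m0 <= k)%N -> parents (k + j * p) = parents k.
Proof.
move=> mk; elim: j => [|j IH]; first by rewrite addn0.
by rewrite mulSn addnCA addnC per ?IH // (leq_trans mk) // leq_addr.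
Qed.

(** The representative of [k] in the preperiod followed by one period. *)
Definition degclass k := if (k < m0)%N then k else (m0 + (k - m0) %% p)%N.

Lemma degclass_lt k : (degclass k < (m0 + p).+1)%N.
Proof.
rewrite /degclass; case: (ltnP k m0) => h; first by lia.
by rewrite ltnS leq_add2l ltnW // ltn_pmod.
Qed.

Lemma degclass_add k l : degclass (degclass k + l) = degclass (k + l).
Proof.
rewrite {2}/degclass; case: ltnP => // mk; rewrite /degclass !ifN; try lia.
have -> : (m0 + (k - m0) %% p + l - m0 = (k - m0) %% p + l)%N by lia.
by rewrite modnDml; congr (_ + _ %% _)%N; lia.
Qed.

Lemma parents_degclass k l : parents (degclass k + l) = parents (k + l).
Proof.
rewrite /degclass; case: ltnP => // mk.
have e : (k + l = m0 + (k - m0) %% p + l + (k - m0) %/ p * p)%N.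
  have := divn_eq (k - m0) p; move: ((k - m0) %/ p * p)%N ((k - m0) %% p)%N; lia.
by rewrite [in RHS]e parents_per //; lia.
Qed.

(** A live state holds the degree class and the rank of the word read so far; [None] is the sink
    reached once the word is not normal. *)
Definition delta (q : option ('I_(m0 + p).+1 * 'I_C)) a :
    option ('I_(m0 + p).+1 * 'I_C) :=
  if q is Some (k, i) then
    if (a, i) \in parents (k + d a)
    then Some (inord (degclass (k + d a)), inord (index (a, i) (parents (k + d a))))
    else None
  else None.

Definition start : option ('I_(m0 + p).+1 * 'I_C) :=
  if `[< normal [::] >] then Some (inord 0, inord 0) else None.

(** The rank of [rcons w a] is the position of the pair of [a] and the rank of [w] in the list of
    parents, and this list depends only on the degree class. *)
Lemma run_normal w : foldl delta start w =
  if `[< normal w >]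
  then Some (inord (degclass (wdeg d w)), inord (index w (level (wdeg d w))))
  else None.
Proof.
elim/last_ind: w => [|w a IH].
  rewrite /= /start; case: ifP => // nn.
  by rewrite /degclass m0_gt0 level0 /= nn.
rewrite foldl_rcons IH; case: asboolP => nw; last first.
  by case: asboolP => // /normal_rcons.
rewrite /delta inordK ?degclass_lt // parents_degclass degclass_add -wdeg_rcons.
set m := wdeg d (rcons w a); have m_gt0 : (0 < m)%N.
  by rewrite /m wdeg_rcons; have := d_pos a; lia.
have mE : (m - d a = wdeg d w)%N by rewrite /m wdeg_rcons addnK.
have wl : w \in level (m - d a) by apply/mem_level.
rewrite -mE; set i := inord _.
have iE : i = index w (level (m - d a)) :> nat by rewrite inordK ?index_level.
have xv : valid m (a, i).
  by rewrite /valid /= iE index_mem wl andbT /m wdeg_rcons leq_addl.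
have xw : cword m (a, i) = rcons w a by rewrite /cword /cword_of /= iE nth_index.
rewrite -xw -valid_parents //; case: ifP => // xP.
congr (Some (_, inord _)); rewrite -nth_index_parents // index_uniq ?level_uniq //.
by rewrite -size_parents // index_mem.
Qed.

Lemma normal_regular : regular_lang normal.
Proof.
exists (option ('I_(m0 + p).+1 * 'I_C)), start, delta, isSome => w.
rewrite run_normal; split=> [nw|]; first by rewrite (asboolT nw).
by case: asboolP.
Qed.

(** The dimensions have period [p] from [m0] on, so multiplying the series by [1 - X^p] kills all
    coefficients from degree [m0 + p] on. *)
Lemma hilbert_periodic : hilbert_rational d R.
Proof.
exists (fun k => size (level k)); split=> [k|]; first exact: graded_dim_level.
pose Q : {poly rat} := 1 - 'X^p.
pose S k := \sum_(i < k.+1) Q`_i * (size (level (k - i)))%:R.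
exists (\poly_(k < m0 + p) S k), Q; split.
  by rewrite coefB coef1 coefXn eqxx (ltn_eqF p_gt0) subr0.
move=> k; rewrite coef_poly; case: ltnP => // mk.
have pk : (p < k.+1)%N by lia.
pose ip := Ordinal pk.
rewrite (bigD1 ord0) //= (bigD1 ip) /=; last by rewrite -val_eqE /= -lt0n.
rewrite big1 => [|i /andP[i0 ip0]].
  rewrite !coefB !coef1 !coefXn !eqxx subn0 (gtn_eqF p_gt0) (ltn_eqF p_gt0).
  rewrite subr0 sub0r mul1r mulN1r addr0.
  suff -> : size (level k) = size (level (k - p)) by rewrite subrr.
  rewrite -!size_parents; [|lia|lia].
  by rewrite -[in RHS]per; [congr (size (parents _)); lia | lia].
rewrite coefB coef1 coefXn.
have /negPf -> : (i : nat) != 0%N by [].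
have /negPf -> : (i : nat) != p by [].
by rewrite subrr mul0r.
Qed.

End Automaton.

(** The ground field enters only here: an endomorphism fixing the relations and having finitely many
    fixed points confines the matrix entries to a finite set. *)
Lemma automaton_of_fixing_morphism (psi : {rmorphism K -> K}) (E : seq K) :
  (forall r t, r \in R -> t \in r -> psi t.1 = t.1) ->
  (forall c, psi c = c -> c \in E) ->
  regular_lang normal /\ hilbert_rational d R.
Proof.
move=> psi_R psi_E; have [m0 [p [m0_gt0 p_gt0 per]]] := parents_periodic psi_R psi_E.
by split; [apply: normal_regular per | apply: hilbert_periodic per].
Qed.

End NormalWords.

(** * Algebraic extensions of finite fields *)

Section AlgebraicOverFinite.
Variables (F : finFieldType) (K : fieldType) (iota : {rmorphism F -> K}) (p : nat).
Hypothesis charK : p \in [pchar K].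

Lemma frobenius_iter N : exists psi : {rmorphism K -> K}, forall x, psi x = x ^+ (p ^ N).
Proof.
elim: N => [|N [psi psiE]].
  by exists (idfun : {rmorphism K -> K}) => x; rewrite expr1.
exists (GRing.pFrobenius_aut charK \o psi : {rmorphism K -> K}) => x.
by rewrite /= GRing.pFrobenius_autE psiE -exprM expnSr.
Qed.

(** The powers of [x] are values of remainders modulo [q], of which there are finitely many. Hence
    two Frobenius powers of [x] coincide, and injectivity of the smaller one cancels it. *)
Lemma algebraic_frobenius_fixed x :
  (exists2 q : {poly F}, q != 0 & root (map_poly iota q) x) ->
  exists2 N, (0 < N)%N & x ^+ (p ^ N) = x.
Proof.
case=> q q0 qx.
have evq k : x ^+ k = (map_poly iota ('X^k %% q)).[x].
  have := congr1 (fun r => (map_poly iota r).[x]) (divp_eq 'X^k q).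
  rewrite rmorphD rmorphM /= hornerD hornerM (eqP qx) mulr0 add0r => <-.
  by rewrite map_polyXn hornerXn.
pose f (k : 'I_(#|{: 'rV[F]_(size q)}|.+1)) : 'rV[F]_(size q) :=
  poly_rV ('X^(p ^ k) %% q).
have /injectivePn[k [l kl /(congr1 rVpoly)]] : ~~ injectiveb f.
  by apply/injectiveP => /leq_card; rewrite card_ord ltnn.
rewrite !poly_rV_K; [|by rewrite ltnW // ltn_modp..] => e.
have {e} e : x ^+ (p ^ k) = x ^+ (p ^ l) by rewrite evq e -evq.
have fixed (i j : nat) : (i < j)%N -> x ^+ (p ^ i) = x ^+ (p ^ j) ->
    exists2 N, (0 < N)%N & x ^+ (p ^ N) = x.
  move=> ij eij; exists (j - i)%N; first by rewrite subn_gt0.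
  have [psi psiE] := frobenius_iter i; apply: (fmorph_inj psi).
  by rewrite !psiE -exprM -expnD subnK ?eij // ltnW.
case: (ltngtP k l) => h; [exact: fixed h e | exact: fixed h (esym e) |].
by rewrite (val_inj h) eqxx in kl.
Qed.

Lemma expr_frobenius_mul (x : K) N l : x ^+ (p ^ N) = x -> x ^+ (p ^ (l * N)) = x.
Proof.
by move=> xN; elim: l => [|l IH]; rewrite ?expr1 // mulSn expnD exprM xN.
Qed.

Lemma common_frobenius_fixed (xs : seq K) :
  (forall x : K, exists2 q : {poly F}, q != 0 & root (map_poly iota q) x) ->
  exists2 N, (0 < N)%N & {in xs, forall x, x ^+ (p ^ N) = x}.
Proof.
move=> alg; elim: xs => [|x xs [N N0 IH]]; first by exists 1%N.
have [M M0 xM] := algebraic_frobenius_fixed (alg x).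
exists (M * N)%N => [|y]; first by rewrite muln_gt0 M0.
rewrite in_cons => /orP[/eqP ->|/IH]; last exact: expr_frobenius_mul.
by rewrite mulnC; apply: expr_frobenius_mul.
Qed.

End AlgebraicOverFinite.

(** A list of distinct roots is either complete or can be extended by one more; the bound on the
    number of roots stops the process at [size q]. *)
Lemma roots_seq (K : idomainType) (q : {poly K}) : q != 0 ->
  exists E : seq K, forall x, root q x -> x \in E.
Proof.
move=> q0.
have grow k : (exists E : seq K, forall x, root q x -> x \in E) \/
    exists E : seq K, [/\ size E = k, uniq E & all (root q) E].
  elim: k => [|k [h|[E [Ek uE rE]]]]; [by right; exists [::] | by left |].
  have [h|/existsNP[x]] := EM (forall x, root q x -> x \in E).
    by left; exists E.
  move=> /not_implyP[rx /negP xE]; right; exists (x :: E).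
  by rewrite /= Ek xE uE rx rE.
have [//|[E [Ek uE rE]]] := grow (size q).
by have := max_poly_roots q0 rE uE; rewrite Ek ltnn.
Qed.

(** A relation may be homogeneous as an element and yet be written with cancelling terms of other
    degrees. Dropping these terms leaves the ideal unchanged and gives [shom]. *)
Lemma strictly_homogeneous_relations (K : fieldType) n (d : 'I_n -> nat)
    (R : seq (ncpoly K n)) : (forall r, r \in R -> homog_pos d r) ->
  exists2 R', in_ideal R = in_ideal R' &
    forall r, r \in R' -> exists2 k, (0 < k)%N & shom d k r.
Proof.
move=> Rh; have /choice[kk kkP] : forall r : ncpoly K n, exists k,
    r \in R -> (0 < k)%N /\ homog_of_deg d r k.
  move=> r; have [/Rh[k k0 rk]|nr] := boolP (r \in R); first by exists k.
  by exists 0%N.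
have gen (S : seq (ncpoly K n)) r : r \in S -> in_ideal S r.
  move/(in_ideal_mon 1 [::] [::]); apply: in_ideal_eq => w.
  by rewrite coef_scale mul1r.
exists [seq hpart d (kk r) r | r <- R].
  apply/funext => f; apply/propext; split; apply: sub_in_ideal => r.
    move=> rR; have [_ /hpart_homog rh] := kkP _ rR.
    by apply: in_ideal_eq (gen _ _ (map_f _ rR)) => w; rewrite rh.
  case/mapP => r' r'R ->; have [_ /hpart_homog rh] := kkP _ r'R.
  exact: in_ideal_eq rh (gen _ _ r'R).
move=> r /mapP[r' r'R ->]; have [k0 _] := kkP _ r'R.
by exists (kk r') => //; apply: shom_hpart.
Qed.

Theorem theorem3p1
  (F : finFieldType) (K : fieldType) (iota : {rmorphism F -> K})
  (K_alg : forall x : K, exists2 p : {poly F}, p != 0 & root (map_poly iota p) x)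
  (n : nat) (d : 'I_n -> nat) (d_pos : forall a, (0 < d a)%N)
  (R : seq (ncpoly K n)) (R_homog : forall r, r \in R -> homog_pos d r)
  (lin : linear_growth d R)
  (sigma : {perm 'I_n}) :
  regular_lang (normal_word d (fun a => nat_of_ord (sigma a)) R) /\
  hilbert_rational d R.
Proof.
have [R' RR' R'h] := strictly_homogeneous_relations R_homog.
move: lin; rewrite /linear_growth /regular_lang /normal_word /hilbert_rational.
rewrite /graded_dim /indep_mod RR' => -[C0 growth].
have s_inj : injective (fun a => nat_of_ord (sigma a)).
  by move=> a b /val_inj/perm_inj.
have growth' k fs : indep_mod d R' k fs -> (size fs <= C0.+1)%N.
  by move=> h; apply/leqW/(growth k fs).
have [p p_pr charF] := finPcharP F.
have charK : p \in [pchar K] by apply: rmorph_pchar charF.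
pose xs := flatten [seq [seq t.1 | t <- r] | r <- R'].
have [N N0 xsN] := common_frobenius_fixed charK xs K_alg.
have [psi psiE] := frobenius_iter charK N.
(* The fixed points of [psi] are the roots of this polynomial. *)
have [|E EP] := @roots_seq K ('X^(p ^ N) - 'X).
  (* Its coefficient at [X] is -1, because [0 < N] gives [1 < p ^ N]. *)
  apply/eqP => /(congr1 (fun q : {poly K} => q`_1)); rewrite coefB coefXn coefX coef0.
  have : (1 < p ^ N)%N by rewrite -(expn0 p) ltn_exp2l // prime_gt1.
  by case: (p ^ N)%N => [|[|q]] // _ /eqP; rewrite sub0r oppr_eq0 oner_eq0.
apply: (automaton_of_fixing_morphism d_pos s_inj R'h growth' (psi := psi) (E := E)).
  move=> r t rR tr; rewrite psiE; apply: xsN.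
  by apply/flatten_mapP; exists r => //; apply: map_f.
move=> c; rewrite psiE => cE; apply: EP.
by rewrite /root !hornerE cE subrr.
Qed.
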